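(* Let $\theta_0=(W(0),V(0))\in\mathbb{R}^D$ and set $a=\sqrt{\mathcal{L}(\theta_0)}$, $\alpha=\sigma_{\min}(H(\theta_0)^T)$, $c_1=2\sqrt2\|X\|_{op}^2\|V(0)\|_F$, $c_2=2\|X\|_{op}^3\|W(0)\|_F$, $c=\|X\|_{op}^2$. Assume $\alpha>0$ and $$F(\theta_0,X,Y):=\Big(\frac{ac_1}{\alpha^3}+\frac{a^2c_2}{\alpha^5}\Big)\exp\Big(\frac{4ca^2}{\alpha^4}\Big)<\frac18.$$ Then every solution $\theta\colon[0,T)\to\mathbb{R}^D$ of the differential inclusion $\theta(0)=\theta_0$, $\dot\theta(t)\in-\partial\mathcal{L}(\theta(t))$ for a.e. $t$, can be extended to a solution on $[0,\infty)$, and every such extension satisfies, for all $t\ge0$, $$\mathcal{L}(\theta(t))\le\mathcal{L}(\theta(0))\exp(-t\alpha^2),$$ and, with $u=4\|X\|_{op}\sqrt{\mathcal{L}(\theta(0))}/\alpha^2$, $$\|\theta(t)-\theta(0)\|\le u\|\theta(0)\|e^u.$$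
   Context: Fixed $X\in\mathbb{R}^{N\times d_0}$, $Y\in\mathbb{R}^{N\times d_2}$. Parameters $\theta=(W,V)$, $W\in\mathbb{R}^{d_0\times d_1}$, $V\in\mathbb{R}^{d_1\times d_2}$, identified with a vector in $\mathbb{R}^D$, $D=d_0d_1+d_1d_2$, with Euclidean norm $\|\theta\|$. $\phi(x)=\max(x,0)$ entrywise, $H(\theta)=\phi(XW)$, $\hat Y=H(\theta)V$, $\mathcal{L}(\theta)=\frac12\|Y-\hat Y\|_F^2$. $\partial$ is the Clarke subdifferential; solutions are absolutely continuous curves. $\sigma_{\min}(A)=\sqrt{\lambda_{\min}(A^TA)}$. *)

(* Defs.v *)
From HB Require Import structures.
From mathcomp Require Import all_boot all_order all_algebra.
From mathcomp Require Import all_classical all_reals all_analysis.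
Set Implicit Arguments. Unset Strict Implicit. Unset Printing Implicit Defensive.
Import Order.TTheory GRing.Theory Num.Theory.
Import numFieldNormedType.Exports.
Local Open Scope classical_set_scope.
Local Open Scope ring_scope.

Section Defs.
Context {R : realType}.

Definition frob {m n} (A : 'M[R]_(m, n)) : R :=
  Num.sqrt (\sum_(i < m) \sum_(j < n) A i j ^+ 2).

Definition relu {m n} (A : 'M[R]_(m, n)) : 'M[R]_(m, n) :=
  map_mx (fun x => Num.max x 0) A.

Definition lambda_min {n} (M : 'M[R]_n) : R := inf [set a | eigenvalue M a].

Definition sigma_min {m n} (A : 'M[R]_(m, n)) : R :=
  Num.sqrt (lambda_min (A^T *m A)).

Definition opnorm {m n} (A : 'M[R]_(m, n)) : R :=
  sup [set frob (A *m v) | v in [set v : 'cV[R]_n | frob v <= 1]].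

Definition param (d0 d1 d2 : nat) := ('M[R]_(d0, d1) * 'M[R]_(d1, d2))%type.

Definition pnorm {d0 d1 d2} (th : param d0 d1 d2) : R :=
  Num.sqrt (frob th.1 ^+ 2 + frob th.2 ^+ 2).

Definition pdot {d0 d1 d2} (th xi : param d0 d1 d2) : R :=
  \sum_(i < d0) \sum_(j < d1) th.1 i j * xi.1 i j
  + \sum_(i < d1) \sum_(j < d2) th.2 i j * xi.2 i j.

Definition loss {N d0 d1 d2} (X : 'M[R]_(N, d0)) (Y : 'M[R]_(N, d2))
  (th : param d0 d1 d2) : R :=
  2^-1 * frob (Y - relu (X *m th.1) *m th.2) ^+ 2.

(* Clarke subdifferential: xi \in \partial f(x) iff for every direction v,
   f°(x; v) := limsup_{y -> x, t \downarrow 0} (f (y + t v) - f y) / t >= <xi, v>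
   (the limsup inequality written out with epsilon/delta). *)
Definition clarke_subdiff {d0 d1 d2} (f : param d0 d1 d2 -> R)
  (x xi : param d0 d1 d2) : Prop :=
  forall v : param d0 d1 d2, forall e : R, 0 < e -> forall dl : R, 0 < dl ->
    exists y : param d0 d1 d2, exists t : R,
      [/\ pnorm (y - x) < dl, 0 < t, t < dl &
          pdot xi v - e <= (f (y + t *: v) - f y) / t].

Definition abs_cont_on {d0 d1 d2} (a b : R) (f : R -> param d0 d1 d2) : Prop :=
  forall e : R, 0 < e -> exists dl : R, 0 < dl /\
    forall (n : nat) (u w : nat -> R),
      (forall k, (k < n)%N -> a <= u k /\ u k <= w k /\ w k <= b) ->
      (forall k, (k.+1 < n)%N -> w k <= u k.+1) ->
      \sum_(k < n) (w k - u k) < dl ->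
      \sum_(k < n) pnorm (f (w k) - f (u k)) < e.

Definition is_solution {N d0 d1 d2} (X : 'M[R]_(N, d0)) (Y : 'M[R]_(N, d2))
  (th0 : param d0 d1 d2) (T : \bar R) (th : R -> param d0 d1 d2) : Prop :=
  [/\ th 0 = th0,
      (forall b : R, 0 <= b -> (b%:E < T)%E -> abs_cont_on 0 b th) &
      (@lebesgue_measure R).-negligible
        [set t : R | [/\ 0 <= t, (t%:E < T)%E &
           ~ (derivable th t 1 /\
              clarke_subdiff (loss X Y) (th t) (- 'D_1 th t))]]].

End Defs.

(* Main.v *)
Require Import Defs.
From HB Require Import structures.
From mathcomp Require Import all_boot all_order all_algebra.
From mathcomp Require Import all_classical all_reals all_analysis.
From mathcomp Require Import measurable_realfun ring lra.
Set Implicit Arguments. Unset Strict Implicit. Unset Printing Implicit Defensive.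
Import Order.TTheory GRing.Theory Num.Theory.
Import numFieldNormedType.Exports.
Local Open Scope classical_set_scope.
Local Open Scope ring_scope.

(* At almost every time t a solution is differentiable, satisfies the inclusion,
   and no preactivation (X W)_ij vanishes with nonzero speed, because such times
   are isolated.  In the direction theta'(t) the loss is then differentiable,
   uniformly near theta(t), so every Clarke subgradient has the same pairing with
   theta'(t) and d/dt L = - |theta'|^2.  The V-component of a subgradient is
   H^T (HV - Y), hence |theta'|^2 >= alpha^2 L as long as H stays within alpha/4
   of H(theta_0), which gives the exponential decay of L.  With r(t) the integral
   of the resulting bound on |X| |HV - Y|, the displacements of W and V satisfy
   |W'| <= r' |V| and |V'| <= r' |W|, whose supersolution
   w = (w_0 + v_0 r) e^(r^2/2), v = (v_0 + w_0 r) e^(r^2/2) yields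
   |H - H(theta_0)| <= 2 alpha F < alpha/4, closing the bootstrap.

   These bounds make a solution on [0,T) Lipschitz, so it has a limit at T.  From
   there it is continued by a limit, along an ultrafilter, of implicit Euler
   schemes for L with approximate minimizers.  The limit is locally Lipschitz and,
   by averaging the discrete inclusions, satisfies the inclusion at every point of
   differentiability. *)

(** * Frobenius inner product, operator norm and smallest singular value *)

(** The obstacle is that at a kink of the ReLU different Clarke subgradients may pair differently
    with the same direction, so no chain rule holds at every time; discarding transversal crossings
    restores one almost everywhere. The resulting differential inequalities are never integrated: an
    absolutely continuous function is compared with an explicit monotone function by a covering
    argument, so that every Grönwall-type estimate reduces to choosing a comparison function.

    The shape of F comes from the system w' = v, v' = w in the variable r. Its solutions combine
    cosh r and sinh r, which are at most e^(r^2/2) and r e^(r^2/2), and r stays below some rho with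
    rho^2/2 = 4 c a^2 / alpha^4. The tolerance alpha/4 leaves |theta'|^2 >= 2 (3/4)^2 alpha^2 L,
    more than alpha^2 L, and the threshold 1/8 is exactly what turns 2 alpha F into less than
    alpha/4.

    The continuation uses only that L is nonnegative and locally Lipschitz. An ultrafilter selects
    limits at all real times at once, in place of an equicontinuity argument with subsequences. *)

Section Bilinear.
Context {R : realType} {V : lmodType R} (B : V -> V -> R).

(** One abstraction serves three instances: the Frobenius product, the product on parameters, and
    the form <x, P y> of a symmetric matrix known only to be semidefinite. *)
Definition psd_form :=
  [/\ forall x y, B x y = B y x,
      forall x y z, B (x + y) z = B x z + B y z,
      forall k x y, B (k *: x) y = k * B x y &
      forall x, 0 <= B x x].

Hypothesis HB : psd_form.

Lemma psd_formDr x y z : B x (y + z) = B x y + B x z.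
Proof. by case: HB => s D _ _; rewrite s D !(s x). Qed.

Lemma psd_formZr k x y : B x (k *: y) = k * B x y.
Proof. by case: HB => s _ Z _; rewrite s Z (s x). Qed.

Lemma psd_form_CS x y : B x y ^+ 2 <= B x x * B y y.
Proof.
case: HB => s D Z p.
have key k : 0 <= B x x + 2 * k * B x y + k ^+ 2 * B y y.
  have := p (x + k *: y).
  rewrite D !psd_formDr !Z !psd_formZr (s y x); lra.
have [y0|y0] := eqVneq (B y y) 0.
  have [->|xy0] := eqVneq (B x y) 0; first by rewrite y0 mulr0 expr0n.
  (* When [B y y = 0] the polynomial in k is affine, and this k gives it the value -1. *)
  have := key (- (B x x + 1) / (2 * B x y)).
  rewrite y0 mulr0 addr0.
  have -> : 2 * (- (B x x + 1) / (2 * B x y)) * B x y = - (B x x + 1).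
    by field.
  lra.
have yp : 0 < B y y by rewrite lt_def y0 p.
have := key (- B x y / B y y).
have -> : B x x + 2 * (- B x y / B y y) * B x y
    + (- B x y / B y y) ^+ 2 * B y y = (B x x * B y y - B x y ^+ 2) / B y y.
  by field.
by rewrite pmulr_lge0 ?invr_gt0// subr_ge0.
Qed.

Lemma psd_form_le_sqrt x y :
  B x y <= Num.sqrt (B x x) * Num.sqrt (B y y).
Proof.
case: HB => _ _ _ p.
rewrite -sqrtrM// (le_trans (ler_norm _))// -sqrtr_sqr ler_wsqrtr//.
exact: psd_form_CS.
Qed.

Lemma psd_form_triangle x y :
  Num.sqrt (B (x + y) (x + y)) <= Num.sqrt (B x x) + Num.sqrt (B y y).
Proof.
case: HB => s D _ p.
rewrite -(@ler_pXn2r _ 2)// ?nnegrE ?addr_ge0 ?sqrtr_ge0//.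
rewrite sqr_sqrtr// sqrrD !sqr_sqrtr// D !psd_formDr (s y x).
have := psd_form_le_sqrt x y; lra.
Qed.

End Bilinear.

Section Frobenius.
Context {R : realType}.

Definition fdot {m n} (A B : 'M[R]_(m, n)) : R :=
  \sum_(i < m) \sum_(j < n) A i j * B i j.

Lemma fdotE m n (A B : 'M[R]_(m, n)) : fdot A B = \tr (A *m B^T).
Proof.
apply: eq_bigr => i _; rewrite mxE; apply: eq_bigr => j _; by rewrite mxE.
Qed.

Lemma fdot_psd m n : psd_form (@fdot m n).
Proof.
split=> [A B|A B C|k A B|A].
- by do 2 (apply: eq_bigr => ? _); rewrite mulrC.
- rewrite -big_split; apply: eq_bigr => i _; rewrite -big_split.
  by apply: eq_bigr => j _; rewrite mxE mulrDl.
- rewrite mulr_sumr; apply: eq_bigr => i _; rewrite mulr_sumr.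
  by apply: eq_bigr => j _; rewrite mxE mulrA.
- by do 2 (apply: sumr_ge0 => ? _); rewrite -expr2 sqr_ge0.
Qed.

Lemma fdotC m n (A B : 'M[R]_(m, n)) : fdot A B = fdot B A.
Proof. by case: (@fdot_psd m n). Qed.
Lemma fdotDl m n (A B C : 'M[R]_(m, n)) : fdot (A + B) C = fdot A C + fdot B C.
Proof. by case: (@fdot_psd m n). Qed.
Lemma fdotZl m n k (A B : 'M[R]_(m, n)) : fdot (k *: A) B = k * fdot A B.
Proof. by case: (@fdot_psd m n). Qed.
Lemma fdot_ge0 m n (A : 'M[R]_(m, n)) : 0 <= fdot A A.
Proof. by case: (@fdot_psd m n). Qed.
Lemma fdotDr m n (A B C : 'M[R]_(m, n)) : fdot A (B + C) = fdot A B + fdot A C.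
Proof. exact: (psd_formDr (@fdot_psd m n)). Qed.
Lemma fdotZr m n k (A B : 'M[R]_(m, n)) : fdot A (k *: B) = k * fdot A B.
Proof. exact: (psd_formZr (@fdot_psd m n)). Qed.
Lemma fdotNl m n (A B : 'M[R]_(m, n)) : fdot (- A) B = - fdot A B.
Proof. by rewrite -scaleN1r fdotZl mulN1r. Qed.
Lemma fdotNr m n (A B : 'M[R]_(m, n)) : fdot A (- B) = - fdot A B.
Proof. by rewrite -scaleN1r fdotZr mulN1r. Qed.
Lemma fdot0l m n (A : 'M[R]_(m, n)) : fdot 0 A = 0.
Proof. by rewrite -(scale0r 0) fdotZl mul0r. Qed.

Lemma fdot_mull m n p (A : 'M[R]_(m, n)) (B : 'M[R]_(n, p)) C :
  fdot (A *m B) C = fdot B (A^T *m C).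
Proof.
by rewrite !fdotE trmx_mul trmxK -mulmxA mxtrace_mulC !mulmxA.
Qed.

Lemma frobE m n (A : 'M[R]_(m, n)) : frob A = Num.sqrt (fdot A A).
Proof. by congr Num.sqrt; do 2 (apply: eq_bigr => ? _); rewrite expr2. Qed.

Lemma frob_sqr m n (A : 'M[R]_(m, n)) : frob A ^+ 2 = fdot A A.
Proof. by rewrite frobE sqr_sqrtr// fdot_ge0. Qed.

Lemma frob_ge0 m n (A : 'M[R]_(m, n)) : 0 <= frob A.
Proof. exact: sqrtr_ge0. Qed.

Lemma fdot_CS m n (A B : 'M[R]_(m, n)) : fdot A B <= frob A * frob B.
Proof. by rewrite !frobE; apply: psd_form_le_sqrt; exact: fdot_psd. Qed.

Lemma frobD m n (A B : 'M[R]_(m, n)) : frob (A + B) <= frob A + frob B.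
Proof. by rewrite !frobE; apply: psd_form_triangle; exact: fdot_psd. Qed.

Lemma frobZ m n k (A : 'M[R]_(m, n)) : frob (k *: A) = `|k| * frob A.
Proof.
by rewrite !frobE fdotZl fdotZr mulrA -expr2 sqrtrM ?sqr_ge0// sqrtr_sqr.
Qed.

Lemma frobN m n (A : 'M[R]_(m, n)) : frob (- A) = frob A.
Proof. by rewrite -scaleN1r frobZ normrN1 mul1r. Qed.

Lemma frob0 m n : frob (0 : 'M[R]_(m, n)) = 0.
Proof. by rewrite frobE fdot0l sqrtr0. Qed.

Lemma frob_eq0 m n (A : 'M[R]_(m, n)) : frob A = 0 -> A = 0.
Proof.
move=> A0; have : fdot A A = 0 by rewrite -frob_sqr A0 expr0n.
move=> /eqP; rewrite psumr_eq0; last first.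
  by move=> i _; apply: sumr_ge0 => j _; rewrite -expr2 sqr_ge0.
move=> /allP h; apply/matrixP => i j; rewrite mxE.
move: (h i (mem_index_enum _)) => /=; rewrite psumr_eq0; last first.
  by move=> k _; rewrite -expr2 sqr_ge0.
move=> /allP/(_ j (mem_index_enum _)) /=.
by rewrite -expr2 sqrf_eq0 => /eqP.
Qed.

Lemma frob_entry m n (A : 'M[R]_(m, n)) i j : `|A i j| <= frob A.
Proof.
rewrite -sqrtr_sqr ler_wsqrtr// (bigD1 i)//= (bigD1 j)//=.
rewrite -addrA lerDl addr_ge0//.
  by apply: sumr_ge0 => ? _; rewrite sqr_ge0.
by do 2 (apply: sumr_ge0 => ? _); rewrite sqr_ge0.
Qed.

Lemma frob_le_entries m n (A B : 'M[R]_(m, n)) :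
  (forall i j, `|A i j| <= `|B i j|) -> frob A <= frob B.
Proof.
move=> h; rewrite ler_wsqrtr//.
apply: ler_sum => i _; apply: ler_sum => j _.
rewrite -(real_normK (num_real (A i j))) -(real_normK (num_real (B i j))).
by rewrite ler_pXn2r// nnegrE.
Qed.

Lemma frob_sqr_col m n (A : 'M[R]_(m, n)) :
  frob A ^+ 2 = \sum_(j < n) frob (col j A) ^+ 2.
Proof.
rewrite frob_sqr /fdot exchange_big; apply: eq_bigr => j _.
rewrite frob_sqr; apply: eq_bigr => i _; by rewrite big_ord1 !mxE.
Qed.

Lemma frob_trmx m n (A : 'M[R]_(m, n)) : frob A^T = frob A.
Proof.
rewrite /frob exchange_big; congr Num.sqrt.
by do 2 (apply: eq_bigr => ? _); rewrite mxE.
Qed.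

Lemma frobM m n p (A : 'M[R]_(m, n)) (B : 'M[R]_(n, p)) :
  frob (A *m B) <= frob A * frob B.
Proof.
rewrite -(@ler_pXn2r _ 2)// ?nnegrE ?mulr_ge0 ?frob_ge0//.
rewrite exprMn -(frob_trmx A) (frob_sqr_col A^T) (frob_sqr_col B).
rewrite frob_sqr /fdot big_distrlr /=.
apply: ler_sum => i _; apply: ler_sum => j _.
rewrite -expr2 (_ : (A *m B) i j = fdot (col i A^T) (col j B)).
  rewrite !frob_sqr; apply: psd_form_CS; exact: fdot_psd.
rewrite mxE /fdot; apply: eq_bigr => k _; by rewrite big_ord1 !mxE.
Qed.

(** Squared Frobenius norms add up over columns, so a bound on vectors passes to matrices with the
    same constant. *)
Lemma frobM_le_cols m n p (A : 'M[R]_(m, n)) (c : R) (B : 'M[R]_(n, p)) :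
  0 <= c -> (forall v : 'cV_n, frob (A *m v) <= c * frob v) ->
  frob (A *m B) <= c * frob B.
Proof.
move=> c0 h; rewrite -(@ler_pXn2r _ 2)// ?nnegrE ?mulr_ge0 ?frob_ge0//.
rewrite exprMn !frob_sqr_col mulr_sumr; apply: ler_sum => j _.
rewrite -exprMn ler_pXn2r// ?nnegrE ?mulr_ge0 ?frob_ge0//.
by rewrite colE -mulmxA -colE.
Qed.

Lemma frobM_ge_cols m n p (A : 'M[R]_(m, n)) (c : R) (B : 'M[R]_(n, p)) :
  0 <= c -> (forall v : 'cV_n, c * frob v <= frob (A *m v)) ->
  c * frob B <= frob (A *m B).
Proof.
move=> c0 h; rewrite -(@ler_pXn2r _ 2)// ?nnegrE ?mulr_ge0 ?frob_ge0//.
rewrite exprMn !frob_sqr_col mulr_sumr; apply: ler_sum => j _.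
rewrite -exprMn ler_pXn2r// ?nnegrE ?mulr_ge0 ?frob_ge0//.
by rewrite [in leRHS]colE -mulmxA -colE.
Qed.

Lemma opnorm_has_sup m n (X : 'M[R]_(m, n)) :
  has_sup [set frob (X *m v) | v in [set v : 'cV[R]_n | frob v <= 1]].
Proof.
split; first by exists (frob (X *m (0 : 'cV_n))), 0 => //=; rewrite frob0.
exists (frob X) => _ [v /= v1 <-].
by rewrite (le_trans (frobM _ _))// ler_piMr// frob_ge0.
Qed.

Lemma opnorm_ge0 m n (X : 'M[R]_(m, n)) : 0 <= opnorm X.
Proof.
rewrite /opnorm; apply: ub_le_sup; first by case: (opnorm_has_sup X).
by exists 0 => /=; rewrite ?mulmx0 frob0.
Qed.

Lemma opnormM m n p (X : 'M[R]_(m, n)) (W : 'M[R]_(n, p)) :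
  frob (X *m W) <= opnorm X * frob W.
Proof.
apply: frobM_le_cols; first exact: opnorm_ge0.
move=> v; have [v0|v0] := eqVneq (frob v) 0.
  by rewrite (frob_eq0 v0) mulmx0 !frob0 mulr0.
have vp : 0 < frob v by rewrite lt_def v0 frob_ge0.
rewrite -ler_pdivrMr//.
have -> : frob (X *m v) / frob v = frob (X *m ((frob v)^-1 *: v)).
  by rewrite -scalemxAr frobZ gtr0_norm ?invr_gt0// mulrC.
rewrite /opnorm; apply: ub_le_sup; first by case: (opnorm_has_sup X).
exists ((frob v)^-1 *: v) => //=.
by rewrite frobZ gtr0_norm ?invr_gt0// mulVf.
Qed.

End Frobenius.

(** * The smallest singular value as a lower bound for multiplication *)

Section SigmaMin.
Context {R : realType}.

Lemma sym_psd_form n (P : 'M[R]_n) : P^T = P ->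
  (forall v : 'cV[R]_n, 0 <= fdot v (P *m v)) ->
  psd_form (fun x y : 'cV[R]_n => fdot x (P *m y)).
Proof.
move=> Ps Pp; split=> // [x y|x y z|k x y].
- by rewrite fdotC fdot_mull Ps.
- by rewrite fdotDl.
- by rewrite fdotZl.
Qed.

(** Cauchy-Schwarz for the form of P, applied to Pv and v, gives |Pv|^2 <= |P| <v, Pv>;
    invertibility gives |v| <= |P^-1| |Pv|. This is coercivity without compactness of the sphere. *)
Lemma pd_unit_lower_bound n (P : 'M[R]_n) : P^T = P ->
  (forall v : 'cV[R]_n, 0 <= fdot v (P *m v)) -> P \in unitmx ->
  exists2 c : R, 0 < c & forall v : 'cV[R]_n, frob v ^+ 2 <= c * fdot v (P *m v).
Proof.
move=> Ps Pp Pu.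
exists (frob (invmx P) ^+ 2 * frob P + 1).
  by rewrite ltr_wpDl// mulr_ge0 ?frob_ge0 ?sqr_ge0.
move=> v; set q := fdot v (P *m v); set w := P *m v.
have vw : frob v <= frob (invmx P) * frob w.
  by rewrite -[v in leLHS](mulKmx Pu) frobM.
have h : frob w ^+ 2 <= frob P * q.
  have := psd_form_CS (sym_psd_form Ps Pp) w v; rewrite -/w -/q -frob_sqr.
  have : fdot w (P *m w) <= frob w * (frob P * frob w).
    by rewrite (le_trans (fdot_CS _ _))// ler_wpM2l ?frob_ge0// frobM.
  move=> h1 h2; have [->|w0] := eqVneq (frob w) 0.
    by rewrite expr0n mulr_ge0 ?frob_ge0// Pp.
  have wp : 0 < frob w ^+ 2 by rewrite exprn_gt0// lt_def w0 frob_ge0.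
  rewrite -(ler_pM2l wp) -expr2 (le_trans h2)//.
  rewrite (le_trans (ler_wpM2r (Pp v) h1))// -/q expr2; lra.
have : frob v ^+ 2 <= frob (invmx P) ^+ 2 * frob w ^+ 2.
  by rewrite -exprMn ler_pXn2r// nnegrE ?mulr_ge0 ?frob_ge0.
have := ler_wpM2l (sqr_ge0 (frob (invmx P))) h.
have : 0 <= q by exact: Pp.
lra.
Qed.

(** The infimum [mu] of <v, Mv> over unit vectors, where M = A^T A, is an eigenvalue of M, hence at
    least [lambda_min M]. No spectral theorem is invoked. *)
Lemma sigma_minM m n p (A : 'M[R]_(m, n)) (B : 'M[R]_(n, p)) :
  sigma_min A * frob B <= frob (A *m B).
Proof.
apply: frobM_ge_cols; first exact: sqrtr_ge0.
set M := A^T *m A.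
have MA (v : 'cV[R]_n) : fdot v (M *m v) = frob (A *m v) ^+ 2.
  by rewrite frob_sqr fdot_mull mulmxA.
have Ms : M^T = M by rewrite trmx_mul trmxK.
suff key (v : 'cV[R]_n) : lambda_min M * frob v ^+ 2 <= frob (A *m v) ^+ 2.
  move=> v; rewrite -(@ler_pXn2r _ 2)// ?nnegrE ?mulr_ge0 ?frob_ge0 ?sqrtr_ge0//.
  rewrite exprMn; have [l0|l0] := leP 0 (lambda_min M).
    by rewrite sqr_sqrtr.
  by rewrite /sigma_min (ler0_sqrtr (ltW l0)) expr0n mul0r sqr_ge0.
move: v => v0; have [v00|v00] := eqVneq (frob v0) 0.
  by rewrite v00 expr0n mulr0 sqr_ge0.
set S := [set fdot v (M *m v) | v in [set v : 'cV[R]_n | frob v = 1]].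
have scale (v : 'cV[R]_n) : frob v != 0 -> S (frob (A *m v) ^+ 2 / frob v ^+ 2).
  move=> v0'; have vp : 0 < frob v by rewrite lt_def v0' frob_ge0.
  exists ((frob v)^-1 *: v) => /=.
    by rewrite frobZ gtr0_norm ?invr_gt0// mulVf.
  rewrite MA -scalemxAr frobZ gtr0_norm ?invr_gt0// exprMn exprVn.
  by rewrite mulrC.
have Sl : lbound S 0 by move=> _ [v _ <-]; rewrite MA sqr_ge0.
have Si : has_inf S by split; [eexists; exact: scale v00 | exists 0].
set mu := inf S.
have muP (v : 'cV[R]_n) : mu * frob v ^+ 2 <= frob (A *m v) ^+ 2.
  have [v'|v'] := eqVneq (frob v) 0; first by rewrite v' expr0n mulr0 sqr_ge0.
  have vp : 0 < frob v ^+ 2 by rewrite exprn_gt0// lt_def v' frob_ge0.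
  rewrite -ler_pdivlMr//; apply: ge_inf; first by exists 0.
  exact: scale.
suff eig : eigenvalue M mu.
  apply: le_trans (muP v0); rewrite ler_wpM2r ?sqr_ge0//.
  apply: ge_inf => //; exists 0 => l /= /eigenvalueP [v vM vn0].
  have : l * frob v^T ^+ 2 = frob (A *m v^T) ^+ 2.
    rewrite -MA -{1}Ms -trmx_mul vM frob_sqr linearZ /=.
    by rewrite fdotZr.
  have vp : 0 < frob v^T ^+ 2.
    rewrite exprn_gt0// lt_def frob_ge0 andbT; apply: contra_neq vn0.
    by rewrite frob_trmx; exact: frob_eq0.
  by move=> e; rewrite -(pmulr_lge0 _ vp) e sqr_ge0.
(* If [mu] is not an eigenvalue, M - mu I is semidefinite and invertible, hence coercive with some
   constant 1/c. A unit vector with <v, Mv> < mu + 1/c then contradicts coercivity. *)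
apply: contrapT => /negP neig.
set P := M - mu%:M.
have Pu : P \in unitmx.
  rewrite -row_free_unit -kermx_eq0.
  by move: neig; rewrite /eigenvalue /= negbK.
have PE (v : 'cV[R]_n) : fdot v (P *m v) = frob (A *m v) ^+ 2 - mu * frob v ^+ 2.
  by rewrite mulmxBl mul_scalar_mx fdotDr fdotNr fdotZr MA !frob_sqr.
have Pp (v : 'cV[R]_n) : 0 <= fdot v (P *m v) by rewrite PE subr_ge0.
have Ps : P^T = P by rewrite linearB /= Ms tr_scalar_mx.
have [c c0 cP] := pd_unit_lower_bound Ps Pp Pu.
have ci : 0 < c^-1 by rewrite invr_gt0.
have [_ [v /= v1 <-] h] := inf_adherent ci Si.
have := cP v; rewrite PE v1 expr1n mulr1.
rewrite -ler_pdivrMl// mulr1 lerBrDl; rewrite MA -/mu in h.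
by rewrite leNgt h.
Qed.

End SigmaMin.

(** * Absolutely continuous functions and almost everywhere inequalities *)

Section AbsoluteContinuity.
Context {R : realType}.
Notation mu := (@lebesgue_measure R).

(** Cousin's lemma in the form of a supremum argument: a property stable under concatenation of
    intervals, and true of all short intervals around each point, reaches from a to b. Intervals
    straddling x are the ones that differentiability at x controls. *)
Lemma straddle_ind (a b : R) (Q : R -> R -> Prop) : a <= b ->
  (forall s t u, a <= s -> s <= t -> t <= u -> u <= b ->
    Q s t -> Q t u -> Q s u) ->
  (forall x, a <= x -> x <= b -> exists2 d, 0 < d & forall s t,
    a <= s -> s <= x -> x <= t -> t <= b -> x - s < d -> t - x < d -> Q s t) ->
  Q a b.
Proof.
move=> ab Qtr Qloc.
set S := [set t | [/\ a <= t, t <= b & Q a t]].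
have Sa : S a.
  split=> //; have [d d0 h] := Qloc a (lexx _) ab.
  by apply: h; rewrite ?subrr.
have Sub : ubound S b by move=> t [].
have Ssup : has_sup S by split; [exists a | exists b].
set c := sup S.
have ac : a <= c by apply: ub_le_sup => //; exists b.
have cb : c <= b by apply: ge_sup => //; exists a.
have [d d0 h] := Qloc c ac cb.
have Qc : Q a c.
  have [t [at_ tb Qt] ct] := sup_adherent d0 Ssup.
  have tc : t <= c by apply: ub_le_sup => //; exists b.
  apply: (Qtr a t c) => //; apply: h => //; rewrite -/c in ct.
    lra.
  by rewrite subrr.
have [bc|cb'] := leP b c; first by have <- : c = b by apply/eqP; rewrite eq_le cb.
set t := Num.min b (c + d / 2).
have ct : c < t by rewrite lt_min cb' ltrDl divr_gt0.
have tb : t <= b by rewrite ge_min lexx.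
have td : t <= c + d / 2 by rewrite ge_min lexx orbT.
have St : S t.
  split=> //; first by rewrite (le_trans ac)// ltW.
  apply: (Qtr a c t) => //; first exact: ltW.
  apply: h => //; [exact: ltW|by rewrite subrr|lra].
have : t <= c by apply: ub_le_sup => //; exists b.
by rewrite leNgt ct.
Qed.

Definition abs_cont_real (a b : R) (f : R -> R) : Prop :=
  forall e : R, 0 < e -> exists dl : R, 0 < dl /\
    forall (n : nat) (u w : nat -> R),
      (forall k, (k < n)%N -> a <= u k /\ u k <= w k /\ w k <= b) ->
      (forall k, (k.+1 < n)%N -> w k <= u k.+1) ->
      \sum_(k < n) (w k - u k) < dl ->
      \sum_(k < n) `|f (w k) - f (u k)| < e.

Lemma negligible_open_cover (E : set R) (d : R) : 0 < d -> mu.-negligible E ->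
  exists U : set R, [/\ open U, E `<=` U & (mu U < d%:E)%E].
Proof.
move=> d0 [E' [mE' E'0 EE']].
have E'fin : (mu E' < +oo)%E by rewrite E'0.
have [U [oU E'U UE']] := lebesgue_regularity_outer mE' E'fin d0.
exists U; split=> //; first exact: subset_trans E'U.
rewrite (_ : U = E' `|` (U `\` E')); last by rewrite setDUK.
have mU : measurable U by exact: open_measurable.
apply: (@le_lt_trans _ _ (mu E' + mu (U `\` E'))%E).
  by apply: measureU2 => //; exact: measurableD.
by rewrite E'0 add0e.
Qed.

Section OpenLength.
Variables (U : set R) (d : R).
Hypotheses (oU : open U) (Ud : (mu U < d%:E)%E).

(** The length of U to the left of t. It makes the total length of intervals inside U additive
    bookkeeping: each such [s, t] is paid for by [m t - m s], and the whole budget is below d. *)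
Let m t := fine (mu (U `&` `]-oo, t]%classic)).

Let mUt t : measurable (U `&` `]-oo, t]%classic).
Proof. by apply: measurableI => //; exact: open_measurable. Qed.

Let mu_lt t : (mu (U `&` `]-oo, t]%classic) < d%:E)%E.
Proof.
apply: le_lt_trans Ud; apply: le_measure; rewrite ?inE//.
- exact: mUt.
- exact: open_measurable.
Qed.

Let mE t : (m t)%:E = mu (U `&` `]-oo, t]%classic).
Proof. by rewrite fineK// ge0_fin_numE// (lt_trans (mu_lt t))// ltry. Qed.

Lemma open_length_ge0 t : 0 <= m t. Proof. exact: fine_ge0. Qed.

Lemma open_length_lt t : m t < d.
Proof. by rewrite -lte_fin mE. Qed.

Lemma open_length_homo s t : s <= t -> m s <= m t.
Proof.
move=> st; rewrite -lee_fin !mE; apply: le_measure; rewrite ?inE; [exact: mUt..|].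
by apply: setIS => x /=; rewrite !in_itv /= => /le_trans; exact.
Qed.

Lemma open_length_sub s t : s <= t -> `[s, t]%classic `<=` U -> t - s <= m t - m s.
Proof.
move=> st stU; rewrite lerBrDr -lee_fin EFinD !mE.
have -> : (t - s)%:E = mu `]s, t]%classic.
  rewrite lebesgue_measure_itv /= lte_fin; case: ltP => // ts.
  by have -> : t = s; [apply/eqP; rewrite eq_le ts | rewrite subrr].
have mI : measurable (`]s, t]%classic : set R) by exact: measurable_itv.
have mIU : measurable (`]s, t]%classic `|` (U `&` `]-oo, s]%classic)).
  exact: measurableU.
rewrite -measureU//=; last 2 first.
- exact: mUt.
- rewrite -subset0 => x [] /=; rewrite !in_itv /= => /andP[sx _] [_].
  by rewrite leNgt sx.
apply: le_measure; rewrite ?inE; [exact: mIU|exact: mUt|].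
move=> x [|[Ux]] /=; rewrite !in_itv /=.
  by move=> /andP[sx xt]; split=> //; apply: stU; rewrite /= in_itv /= (ltW sx).
by move=> xs; split=> //; exact: le_trans st.
Qed.

End OpenLength.

(** The null set E lies in an open U of small measure. Intervals around points of E are chosen
    inside U, where absolute continuity makes the total variation of f small and monotonicity of h
    loses nothing; all other intervals obey the local estimate. The comparison function h stands in
    for an integral. *)
Lemma abs_cont_ae_le (f h : R -> R) (a b : R) (E : set R) : a <= b ->
  abs_cont_real a b f ->
  (forall s t, a <= s -> s <= t -> t <= b -> h s <= h t) ->
  mu.-negligible E ->
  (forall x, a <= x -> x <= b -> ~ E x -> forall e, 0 < e ->
    exists2 d, 0 < d & forall s t, a <= s -> s <= x -> x <= t -> t <= b ->
      x - s < d -> t - x < d -> f t - f s <= h t - h s + e * (t - s)) ->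
  f b - f a <= h b - h a.
Proof.
move=> ab acf hh nE loc; apply/ler_addgt0Pr => e e0.
set e1 := e / 2 / (b - a + 1).
have ba : 0 < b - a + 1 by lra.
have e10 : 0 < e1 by rewrite !divr_gt0.
have [dl [dl0 acd]] := acf (e / 2) ltac:(lra).
have [U [oU EU Ud]] := negligible_open_cover dl0 nE.
pose m t := fine (mu (U `&` `]-oo, t]%classic)).
(* The witnesses list the intervals inside U met so far; concatenating lists makes [Q] stable under
   concatenation of intervals. *)
pose Q s t := exists n u w, [/\
  (forall k, (k < n)%N -> s <= u k /\ u k <= w k /\ w k <= t),
  (forall k, (k.+1 < n)%N -> w k <= u k.+1),
  \sum_(k < n) (w k - u k) <= m t - m s &
  f t - f s <= h t - h s + e1 * (t - s) + \sum_(k < n) `|f (w k) - f (u k)|].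
suff [n [u [w [c1 c2 c3 c4]]]] : Q a b.
  have := acd n u w c1 c2.
  have : \sum_(k < n) (w k - u k) < dl.
    have := open_length_lt oU Ud b; have := open_length_ge0 U a.
    rewrite -/(m a) -/(m b); lra.
  move=> /[swap] /[apply].
  have : e1 * (b - a) <= e / 2.
    by rewrite /e1 -mulrA ler_piMr ?ler_pdivrMl//; lra.
  lra.
apply: straddle_ind => //.
- move=> s t v _ st tv _ [n1 [u1 [w1 [a1 a2 a3 a4]]]] [n2 [u2 [w2 [b1 b2 b3 b4]]]].
  exists (n1 + n2)%N, (fun k => if (k < n1)%N then u1 k else u2 (k - n1)%N),
    (fun k => if (k < n1)%N then w1 k else w2 (k - n1)%N).
  have sumE (g : nat -> nat -> R) (g1 := fun k => g 0%N k) (g2 := g 1%N) :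
    \sum_(k < n1 + n2) (if (k < n1)%N then g1 k else g2 (k - n1)%N) =
    \sum_(k < n1) g1 k + \sum_(k < n2) g2 k.
    rewrite big_split_ord /=; congr (_ + _); apply: eq_bigr => k _.
      by rewrite ltn_ord.
    by rewrite ltnNge leq_addr /= addKn.
  split.
  + move=> k kn; case: ltnP => kn1.
      have [? [? ?]] := a1 k kn1; split=> //; split=> //; exact: le_trans tv.
    have [? [? ?]] := b1 (k - n1)%N ltac:(by rewrite ltn_subLR).
    by split=> //; exact: le_trans st _.
  + move=> k kn; case: (ltnP k.+1 n1) => kn1.
      by rewrite (ltnW kn1); exact: a2.
    case: ltnP => kn1'; last first.
      by rewrite subSn//; apply: b2; rewrite -subSn// ltn_subLR// leqW.
    have [_ [_ wt]] := a1 k kn1'.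
    have [|tu _] := b1 (k.+1 - n1)%N; first by rewrite ltn_subLR.
    exact: le_trans tu.
  + have := sumE (fun i k => if i == 0%N then w1 k - u1 k else w2 k - u2 k).
    rewrite /= => e'.
    rewrite (_ : \sum_(k < n1 + n2) _ = \sum_(k < n1) (w1 k - u1 k) +
      \sum_(k < n2) (w2 k - u2 k)); first by lra.
    by rewrite -e'; apply: eq_bigr => k _; case: ltnP.
  + have := sumE (fun i k => if i == 0%N then `|f (w1 k) - f (u1 k)| else `|f (w2 k) - f (u2 k)|).
    rewrite /= => e'.
    rewrite (_ : \sum_(k < n1 + n2) _ = \sum_(k < n1) `|f (w1 k) - f (u1 k)| +
      \sum_(k < n2) `|f (w2 k) - f (u2 k)|); first by lra.
    by rewrite -e'; apply: eq_bigr => k _; case: ltnP.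
(* Off E the interval is charged to the local estimate and the list is empty; at a point of E it is
   charged to U as a list of one interval. *)
- move=> x ax xb; have [Ex|nEx] := pselect (E x); last first.
    have [d d0 hd] := loc x ax xb nEx e1 e10; exists d => // s t as_ sx xt tb sd td.
    exists 0%N, (fun=> 0), (fun=> 0); split=> //; rewrite big_ord0.
      rewrite subr_ge0; apply: (open_length_homo oU Ud); exact: le_trans xt.
    by rewrite addr0; exact: hd.
  have /nbhs_ballP [d /= d0 dU] : nbhs x U by apply: open_nbhs_nbhs; split=> //; exact: EU.
  exists d => // s t as_ sx xt tb sd td.
  have st : s <= t by exact: le_trans xt.
  exists 1%N, (fun=> s), (fun=> t); split=> //; rewrite big_ord1.
    apply: (open_length_sub oU Ud) => // y /=; rewrite in_itv /= => /andP[sy yt].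
    by apply: dU; rewrite /ball /= ltr_distlC; apply/andP; split; lra.
  have := ler_norm (f t - f s); have := hh s t as_ st tb.
  have : 0 <= e1 * (t - s) by rewrite mulr_ge0 ?(ltW e10) ?subr_ge0.
  lra.
Qed.

End AbsoluteContinuity.

(** * Lipschitz functions are differentiable almost everywhere *)

Section LipschitzDerivable.
Context {R : realType}.
Notation mu := (@lebesgue_measure R).

Lemma lipschitz_continuous (f : R -> R) (K : R) : 
  (forall x y, x <= y -> `|f y - f x| <= K * (y - x)) -> continuous f.
Proof.
move=> fK x; apply/cvgrPdist_lt => e e0.
have K0 : 0 <= K.
  have := fK 0 1 ler01; rewrite subr0 mulr1; exact: le_trans.
have K1 : 0 < K + 1 by lra.
have fK' y z : `|f y - f z| <= K * `|y - z|.
  have [yz|/ltW yz] := leP y z.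
    rewrite distrC (distrC y) (ger0_norm (_ : 0 <= z - y)) ?subr_ge0//.
    exact: fK.
  by rewrite (ger0_norm (_ : 0 <= y - z)) ?subr_ge0//; exact: fK.
near=> y; apply: le_lt_trans (fK' _ _) _.
have : `|x - y| < e / (K + 1).
  near: y; apply: cvgr_dist_lt; first exact: cvg_id.
  by rewrite divr_gt0.
rewrite ltr_pdivlMr// mulrDr mulr1 mulrC.
have := normr_ge0 (x - y).
case: (ltgtP `|x - y| 0) => [|xy _|->]; first by lra.
  by move=> h; apply: lt_trans h; rewrite ltrDl.
by rewrite mulr0.
Unshelve. all: by end_near. Qed.

Lemma cumulative_ocitv (g : cumulative R R) (a b : R) : a < b ->
  lebesgue_stieltjes_measure g `]a, b]%classic = (g b - g a)%:E.
Proof.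
move=> ab; rewrite /lebesgue_stieltjes_measure /measure_extension.
rewrite measurable_mu_extE/=; last exact: is_ocitv.
by rewrite wlength_itv_bnd// ltW.
Qed.

(** Both g and K x - g(x) are nondecreasing, and their Stieltjes measures add up to K times Lebesgue
    measure; a nonnegative summand vanishes where the sum does. *)
Lemma lipschitz_cumulative_dominates (g : cumulative R R) (K : R) : 0 < K ->
  (forall x y, x <= y -> g y - g x <= K * (y - x)) ->
  forall A, measurable A -> mu A = 0%E -> lebesgue_stieltjes_measure g A = 0%E.
Proof.
move=> K0 gK.
pose h x := K * x - g x.
pose k x := K * x : R.
have knd : nondecreasing k by move=> x y xy; rewrite /k ler_pM2l.
have hnd : nondecreasing h.
  by move=> x y xy; rewrite /h; have := gK x y xy; lra.
have krc : forall x, k @ at_right x --> k x.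
  move=> x; apply: right_continuousW.
  apply: (@lipschitz_continuous _ K) => y z yz.
  by rewrite /k -mulrBr normrM !ger0_norm ?subr_ge0// ltW.
have hrc : forall x, h @ at_right x --> h x.
  move=> x; apply: right_continuousW.
  apply: (@lipschitz_continuous _ K) => y z yz.
  rewrite ger0_norm ?subr_ge0 ?hnd// /h.
  have : g y <= g z by apply: cumulative_is_nondecreasing.
  lra.
pose h' : cumulative R R := HB.pack h (isCumulative.Build R _ R h hnd hrc).
pose k' : cumulative R R := HB.pack k (isCumulative.Build R _ R k knd krc).
pose K' := NngNum (ltW K0).
have e1 : forall A, measurable A -> lebesgue_stieltjes_measure k' A =
    measure_add (lebesgue_stieltjes_measure g) (lebesgue_stieltjes_measure h') A.
  apply: lebesgue_stieltjes_measure_unique => X /ocitvP [->|[[a b] /= ab ->]].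
    by rewrite !measure0.
  rewrite [RHS]measure_addE /= (cumulative_ocitv k' ab).
  rewrite (cumulative_ocitv g ab) (cumulative_ocitv h' ab) -EFinD /= /k /h; congr EFin; ring.
have e2 : forall A, measurable A -> lebesgue_stieltjes_measure k' A =
    mscale K' mu A.
  apply: lebesgue_stieltjes_measure_unique => X /ocitvP [->|[[a b] /= ab ->]].
    by rewrite !measure0.
  rewrite [RHS]/mscale/= /lebesgue_measure (cumulative_ocitv k' ab).
  rewrite (cumulative_ocitv _ ab) -EFinM; congr EFin.
  exact: esym (mulrBr _ _ _).
move=> A mA A0; have := e1 A mA; rewrite e2// measure_addE /mscale/= A0 mule0.
move=> /esym/eqP; rewrite padde_eq0 ?measure_ge0//.
by move=> /andP[/eqP].
Qed.

(** By domination the Stieltjes measure of g has a Radon-Nikodym density, so g is an indefinite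
    integral and Lebesgue differentiation applies. The limits 0 and 1 at infinity make that measure
    finite. *)
Lemma lipschitz_cumulative_ae_derivable (g : cumulativeBounded (0:R) (1:R)) (K : R) :
  0 < K ->
  (forall x y, x <= y -> g y - g x <= K * (y - x)) ->
  mu.-negligible [set x | ~ derivable g x 1].
Proof.
move=> K0 gK.
have dom : lebesgue_stieltjes_measure g `<< mu.
  apply/null_content_dominatesP => A mA A0.
  exact: (lipschitz_cumulative_dominates K0 gK).
have [phi [phi0 phifin phiint phiE]] := radon_nikodym_sigma_finite dom.
pose f (x : R) : R := fine (phi x).
have fE : EFin \o f = phi by apply/funext => x; rewrite /f /= fineK.
have intf A : measurable A -> mu.-integrable A (EFin \o f).
  move=> mA; rewrite fE.
  exact: (integrableS measurableT mA (@subsetT _ A) phiint).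
have gE (a x : R) : a < x ->
    \int[mu]_(t in [set` Interval (BRight a) (BRight x)]) f t = g x - g a.
  move=> ax; rewrite /Rintegral.
  have -> : (\int[mu]_(t in [set` Interval (BRight a) (BRight x)]) (f t)%:E =
      \int[mu]_(t in [set` Interval (BRight a) (BRight x)]) phi t)%E.
    by rewrite -fE.
  have mI := @measurable_itv R (Interval (BRight a) (BRight x)).
  by rewrite -(phiE _ mI) /= cumulative_ocitv.
have locf : locally_integrable setT f.
  apply: open_integrable_locally => //; first exact: openT.
  exact: intf.
have key (a : R) : mu.-negligible [set x | a < x /\ ~ derivable g x 1].
  have := @FTC1 R f (BRight a) (fun y => intf _ (measurable_itv _)) locf.
  apply: negligibleS => x /= [ax ndx]; apply: contra_not ndx => /(_ ax) -[dx _].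
  apply: (near_eq_derivable _ (derivableD dx (derivable_cst (g a) x 1))).
  near=> y.
  have ay : a < y by near: y; exact: lt_nbhsr.
  by rewrite -[RHS](subrK (g a)) -(gE _ _ ay).
(* The fundamental theorem is applied with a fixed left endpoint; the endpoints -n exhaust the
   line. *)
have : mu.-negligible (\bigcup_n [set x | - n%:R < x /\ ~ derivable g x 1]).
  by apply: negligible_bigcup => n; exact: key.
apply: negligibleS => x /= dx; exists (Num.bound `|x|) => //=; split=> //.
rewrite ltrNl (le_lt_trans (ler_norm (- x)))// normrN.
by rewrite archi_boundP.
Unshelve. all: by end_near. Qed.

(** Clamping the argument to [a, b], adding a linear term and normalising turns f into a Lipschitz
    distribution function; these operations are undone at interior points. *)
Lemma lipschitz_ae_derivable (f : R -> R) (a b C : R) : a < b ->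
  (forall s t, a <= s -> s <= t -> t <= b -> `|f t - f s| <= C * (t - s)) ->
  mu.-negligible [set t | [/\ a < t, t < b & ~ derivable f t 1]].
Proof.
move=> ab fC.
have C0 : 0 <= C.
  have := fC a b (lexx _) (ltW ab) (lexx _).
  by move=> /(le_trans (normr_ge0 _)); rewrite pmulr_lge0 ?subr_gt0.
pose c x := Num.max a (Num.min b x).
have cE x : (x <= a /\ c x = a) \/ (a <= x <= b /\ c x = x) \/ (b <= x /\ c x = b).
  rewrite /c; case: (leP b x) => bx; first by right; right; rewrite max_r// ltW.
  case: (leP a x) => ax; last by left; rewrite ltW.
  by right; left; rewrite (ltW bx).
have c1 x y : x <= y -> [/\ a <= c x, c x <= c y, c y <= b & c y - c x <= y - x].
  by move=> xy; have [[? ->]|[[/andP[? ?] ->]|[? ->]]] := cE x;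
    have [[? ->]|[[/andP[? ?] ->]|[? ->]]] := cE y; split; lra.
(* The slope C would make [F] monotone; the slope C + 1 also makes its total increase [D] positive,
   so that it can be divided by. *)
pose F x := f (c x) + (C + 1) * c x.
have F1 x y : x <= y -> 0 <= F y - F x <= (2 * C + 1) * (y - x).
  move=> xy; have [ax cxy cyb cyx] := c1 x y xy.
  have := fC _ _ ax cxy cyb; rewrite ler_norml => /andP[h1 h2].
  have : C * (c y - c x) <= C * (y - x) by rewrite ler_wpM2l.
  by rewrite /F; lra.
have ca : c a = a by rewrite /c min_r ?(ltW ab)// maxxx.
have cb : c b = b by rewrite /c minxx max_r// ltW.
set D := F b - F a.
have D0 : 0 < D.
  rewrite /D /F ca cb; have := fC _ _ (lexx _) (ltW ab) (lexx _).
  by rewrite ler_norml => /andP[h1 h2]; lra.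
pose g x := (F x - F a) / D.
pose K := (2 * C + 1) / D.
have K0 : 0 < K by rewrite /K divr_gt0//; lra.
have gK x y : x <= y -> g y - g x <= K * (y - x).
  move=> xy; rewrite /g /K -mulrBl mulrAC ler_pM2r ?invr_gt0//.
  by have /andP[_] := F1 x y xy; lra.
have gnd : nondecreasing g.
  move=> x y xy; rewrite /g ler_pM2r ?invr_gt0//.
  by have /andP[] := F1 x y xy; lra.
have grc : forall x, g @ at_right x --> g x.
  move=> x; apply: right_continuousW.
  apply: (@lipschitz_continuous _ K) => y z yz.
  by rewrite ger0_norm ?subr_ge0 ?gnd// gK.
have gNy : g x @[x --> -oo] --> (0 : R).
  apply: cvg_near_cst; near=> x; rewrite /g /F (_ : c x = c a) ?subrr ?mul0r//.
  by rewrite ca /c; have xa : x <= a by []; rewrite min_r ?max_l// (le_trans xa)// ltW.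
have gy : g x @[x --> +oo] --> (1 : R).
  apply: cvg_near_cst; near=> x; rewrite /g /F (_ : c x = c b).
    by rewrite divff// gt_eqF.
  by rewrite cb /c; have bx : b <= x by []; rewrite min_l ?max_r// ltW.
pose g' : cumulativeBounded (0:R) (1:R) := HB.pack g
  (isCumulative.Build R _ R g gnd grc) (isCumulativeBounded.Build R 0 1 g gNy gy).
have := @lipschitz_cumulative_ae_derivable g' K K0 gK.
apply: negligibleS => t /= [at_ tb ndt]; apply: contra_not ndt => dg.
have d1 := derivableB (derivableM (derivable_cst D t 1) dg)
  (derivableM (derivable_cst (C + 1) t 1) (@derivable_id _ _ t 1)).
apply: (near_eq_derivable _ (derivableD (derivable_cst (F a) t 1) d1)).
near=> x.
have ax : a < x by near: x; exact: lt_nbhsr.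
have xb : x < b by near: x; exact: lt_nbhsl.
have cx : c x = x by rewrite /c min_r ?max_r// ltW.
have -> : f x = F a + (D * g x - (C + 1) * x).
  by rewrite /g mulrC divfK ?gt_eqF// /F cx; ring.
by [].
Unshelve. all: by end_near. Qed.

End LipschitzDerivable.

(** * Euclidean structure on the parameter space *)

Section ParamGeometry.
Context {R : realType} {d0 d1 d2 : nat}.
Notation P := (@param R d0 d1 d2).
Implicit Types x y z : P.

Lemma pdotE x y : pdot x y = fdot x.1 y.1 + fdot x.2 y.2.
Proof. by []. Qed.

Lemma pdot_psd : psd_form (@pdot R d0 d1 d2).
Proof.
split=> [x y|x y z|k x y|x]; rewrite !pdotE /=.
- by rewrite fdotC [in RHS]fdotC; congr (_ + _); exact: fdotC.
- by rewrite !fdotDl addrACA.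
- by rewrite !fdotZl mulrDr.
- by rewrite addr_ge0 ?fdot_ge0.
Qed.

Lemma pdotC x y : pdot x y = pdot y x.
Proof. by case: pdot_psd. Qed.
Lemma pdotDl x y z : pdot (x + y) z = pdot x z + pdot y z.
Proof. by case: pdot_psd. Qed.
Lemma pdotZl k x y : pdot (k *: x) y = k * pdot x y.
Proof. by case: pdot_psd. Qed.
Lemma pdot_ge0 x : 0 <= pdot x x.
Proof. by case: pdot_psd. Qed.
Lemma pdotDr x y z : pdot x (y + z) = pdot x y + pdot x z.
Proof. exact: (psd_formDr pdot_psd). Qed.
Lemma pdotZr k x y : pdot x (k *: y) = k * pdot x y.
Proof. exact: (psd_formZr pdot_psd). Qed.
Lemma pdotNl x y : pdot (- x) y = - pdot x y.
Proof. by rewrite -scaleN1r pdotZl mulN1r. Qed.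
Lemma pdotNr x y : pdot x (- y) = - pdot x y.
Proof. by rewrite -scaleN1r pdotZr mulN1r. Qed.
Lemma pdotBl x y z : pdot (x - y) z = pdot x z - pdot y z.
Proof. by rewrite pdotDl pdotNl. Qed.
Lemma pdot0l x : pdot 0 x = 0.
Proof. by rewrite -(scale0r 0) pdotZl mul0r. Qed.

Lemma pnormE x : pnorm x = Num.sqrt (pdot x x).
Proof. by rewrite /pnorm !frob_sqr. Qed.

Lemma pnorm_sqr x : pnorm x ^+ 2 = pdot x x.
Proof. by rewrite pnormE sqr_sqrtr// pdot_ge0. Qed.

Lemma pnorm_ge0 x : 0 <= pnorm x.
Proof. exact: sqrtr_ge0. Qed.

Lemma pdot_CS x y : pdot x y <= pnorm x * pnorm y.
Proof. by rewrite !pnormE; apply: psd_form_le_sqrt; exact: pdot_psd. Qed.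

Lemma pnormD x y : pnorm (x + y) <= pnorm x + pnorm y.
Proof. by rewrite !pnormE; apply: psd_form_triangle; exact: pdot_psd. Qed.

Lemma pnormZ k x : pnorm (k *: x) = `|k| * pnorm x.
Proof.
by rewrite !pnormE pdotZl pdotZr mulrA -expr2 sqrtrM ?sqr_ge0// sqrtr_sqr.
Qed.

Lemma pnormN x : pnorm (- x) = pnorm x.
Proof. by rewrite -scaleN1r pnormZ normrN1 mul1r. Qed.

Lemma pnormBC x y : pnorm (x - y) = pnorm (y - x).
Proof. by rewrite -pnormN opprB. Qed.

Lemma pnorm0 : pnorm (0 : P) = 0.
Proof. by rewrite pnormE pdot0l sqrtr0. Qed.

Lemma pnormB_le x y z : pnorm (x - z) <= pnorm (x - y) + pnorm (y - z).
Proof. by rewrite -(subrK y x) -[X in pnorm X]addrA addrK pnormD. Qed.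

Lemma pnorm_leD x y : pnorm x <= pnorm y + pnorm (x - y).
Proof. by rewrite -[x in leLHS](subrK y) addrC pnormD. Qed.

Lemma frob1_le x : frob x.1 <= pnorm x.
Proof.
rewrite -(@ler_pXn2r _ 2)// ?nnegrE ?frob_ge0 ?pnorm_ge0//.
by rewrite pnorm_sqr pdotE -!frob_sqr lerDl sqr_ge0.
Qed.

Lemma frob2_le x : frob x.2 <= pnorm x.
Proof.
rewrite -(@ler_pXn2r _ 2)// ?nnegrE ?frob_ge0 ?pnorm_ge0//.
by rewrite pnorm_sqr pdotE -!frob_sqr lerDr sqr_ge0.
Qed.

Lemma pnorm_le_sum x : pnorm x <= frob x.1 + frob x.2.
Proof.
have fg := mulr_ge0 (frob_ge0 x.1) (frob_ge0 x.2).
rewrite -(@ler_pXn2r _ 2)// ?nnegrE ?addr_ge0 ?frob_ge0 ?pnorm_ge0//.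
rewrite pnorm_sqr pdotE -!frob_sqr; lra.
Qed.

Lemma mx_norm_le_frob m n (A : 'M[R]_(m, n)) : `|A| <= frob A.
Proof.
have -> : `|A| = mx_norm A by [].
rewrite mx_normrE; apply: bigmax_le; first exact: frob_ge0.
by move=> i _; exact: frob_entry.
Qed.

Lemma frob_le_mx_norm m n (A : 'M[R]_(m, n)) :
  frob A <= Num.sqrt (m%:R * n%:R) * `|A|.
Proof.
rewrite -(@ler_pXn2r _ 2)// ?nnegrE ?mulr_ge0 ?frob_ge0 ?sqrtr_ge0//.
rewrite exprMn frob_sqr sqr_sqrtr ?mulr_ge0//.
apply: (@le_trans _ _ (\sum_(i < m) \sum_(j < n) `|A| ^+ 2)).
  apply: ler_sum => i _; apply: ler_sum => j _.
  rewrite -expr2 -(real_normK (num_real (A i j))) ler_pXn2r// ?nnegrE//.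
  have -> : `|A| = mx_norm A by [].
  by rewrite mx_normrE; exact: (le_bigmax _ (fun k => `|A k.1 k.2|) (i, j)).
by rewrite !sumr_const !card_ord -mulrnA -[leLHS]mulr_natl mulnC natrM.
Qed.

Lemma norm_le_pnorm x : `|x| <= pnorm x.
Proof.
rewrite ge_max; apply/andP; split; apply: le_trans (mx_norm_le_frob _) _.
  exact: frob1_le.
exact: frob2_le.
Qed.

(** [derivable] refers to the maximum norm on pairs of matrices, the theorem to the Euclidean norm.
    Together with [norm_le_pnorm] this allows derivatives of curves to be restated in [pnorm]. *)
Lemma pnorm_le_norm : exists2 C, 0 < C & forall x, pnorm x <= C * `|x|.
Proof.
pose c1 : R := Num.sqrt (d0%:R * d1%:R).
pose c2 : R := Num.sqrt (d1%:R * d2%:R).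
exists (c1 + c2 + 1); first by rewrite ltr_wpDl// addr_ge0// sqrtr_ge0.
move=> x; apply: le_trans (pnorm_le_sum x) _.
have h1 : `|x.1| <= `|x| by rewrite le_max lexx.
have h2 : `|x.2| <= `|x| by rewrite le_max lexx orbT.
have : c1 * `|x.1| <= c1 * `|x| by rewrite ler_wpM2l// sqrtr_ge0.
have : c2 * `|x.2| <= c2 * `|x| by rewrite ler_wpM2l// sqrtr_ge0.
have := frob_le_mx_norm x.1; have := frob_le_mx_norm x.2.
rewrite -/c1 -/c2; have := normr_ge0 x; lra.
Qed.

Lemma derivable_pnorm (th : R -> P) t : derivable th t 1 ->
  forall e, 0 < e -> exists2 d, 0 < d & forall h, `|h| < d ->
    pnorm (th (t + h) - th t - h *: 'D_1 th t) <= e * `|h|.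
Proof.
move=> dth e e0; have [C C0 hC] := pnorm_le_norm.
have /cvgrPdist_le/(_ (e / C) (divr_gt0 e0 C0)) : 
  h^-1 *: ((th \o shift t) (h *: 1) - th t) @[h --> 0^'] --> 'D_1 th t by [].
move=> /nbhs_ballP [d /= d0' hd]; exists d => // h hlt.
have [->|h0] := eqVneq h 0.
  by rewrite addr0 subrr scale0r subrr pnorm0 normr0 mulr0.
have := hd h; rewrite /ball /= sub0r normrN => /(_ hlt h0).
rewrite /= [h *: 1]mulr1 (addrC h t) => hh.
have -> : th (t + h) - th t - h *: 'D_1 th t =
    (- h) *: ('D_1 th t - h^-1 *: (th (t + h) - th t)).
  by rewrite scalerBr scaleNr scalerA mulNr divff// scaleN1r opprK addrC.
rewrite pnormZ normrN mulrC ler_wpM2r// (le_trans (hC _))//.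
by rewrite mulrC -ler_pdivlMr.
Qed.

Lemma pnorm_derivable (th : R -> P) t v :
  (forall e, 0 < e -> exists2 d, 0 < d & forall h, `|h| < d ->
    pnorm (th (t + h) - th t - h *: v) <= e * `|h|) ->
  derivable th t 1 /\ 'D_1 th t = v.
Proof.
move=> H.
have cv : h^-1 *: ((th \o shift t) (h *: 1) - th t) @[h --> 0^'] --> v.
  apply/cvgrPdist_le => e e0; have [d d0' hd] := H e e0.
  apply/nbhs_ballP; exists d => //= h; rewrite /ball /= sub0r normrN => hlt h0.
  rewrite [h *: 1]mulr1 (addrC h t) distrC.
  have := hd h hlt.
  have -> : th (t + h) - th t - h *: v =
      h *: (h^-1 *: (th (t + h) - th t) - v).
    by rewrite scalerBr scalerA divff// scale1r.
  rewrite pnormZ mulrC ler_pM2r ?normr_gt0//.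
  exact: le_trans (norm_le_pnorm _).
split; first by apply/cvg_ex; exists v.
exact: cvg_lim cv.
Qed.

End ParamGeometry.

(** * The loss and its Clarke subgradients *)

Section Relu.
Context {R : realType}.

Lemma max0_lip (a b : R) : `|Num.max a 0 - Num.max b 0| <= `|a - b|.
Proof.
have h1 := ler_norm (a - b); have h2 := ler_norm (b - a).
rewrite (distrC b a) in h2; have h3 := normr_ge0 (a - b).
by rewrite ler_norml; apply/andP; split;
  case: (leP a 0) => ha; case: (leP b 0) => hb; lra.
Qed.

Lemma frob_relu_lip m n (A B : 'M[R]_(m, n)) :
  frob (relu A - relu B) <= frob (A - B).
Proof. by apply: frob_le_entries => i j; rewrite !mxE max0_lip. Qed.

Lemma frob_relu_le m n (A : 'M[R]_(m, n)) : frob (relu A) <= frob A.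
Proof.
apply: frob_le_entries => i j; rewrite !mxE.
by have := max0_lip (A i j) 0; rewrite maxxx !subr0.
Qed.

End Relu.

Section Loss.
Context {R : realType} {N d0 d1 d2 : nat}.
Variables (X : 'M[R]_(N, d0)) (Y : 'M[R]_(N, d2)).
Notation P := (@param R d0 d1 d2).
Implicit Types x y z v xi th : P.
Notation nX := (opnorm X).
Notation L := (loss X Y).

Definition hid th := relu (X *m th.1).
Definition res th := hid th *m th.2 - Y.

Lemma lossE th : L th = 2^-1 * frob (res th) ^+ 2.
Proof. by rewrite /loss /res -frobN opprB. Qed.

Lemma loss_ge0 th : 0 <= L th.
Proof. by rewrite lossE mulr_ge0 ?sqr_ge0. Qed.

Lemma frob_res th : frob (res th) = Num.sqrt (2 * L th).
Proof. by rewrite lossE mulrA divff// mul1r sqrtr_sqr ger0_norm ?frob_ge0. Qed.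

Lemma frob_hid th : frob (hid th) <= nX * frob th.1.
Proof. exact: le_trans (frob_relu_le _) (opnormM _ _). Qed.

Lemma hid_lip y z : frob (hid y - hid z) <= nX * frob (y.1 - z.1).
Proof.
apply: le_trans (frob_relu_lip _ _) _; rewrite -mulmxBr; exact: opnormM.
Qed.

Lemma res_lip y z :
  frob (res y - res z) <= nX * (frob y.2 + frob z.1) * pnorm (y - z).
Proof.
have -> : res y - res z = (hid y - hid z) *m y.2 + hid z *m (y.2 - z.2).
  rewrite mulmxBl mulmxBr [RHS]addrA subrK /res opprB [LHS]addrA.
  by rewrite subrK.
apply: le_trans (frobD _ _) _.
have h1 : frob ((hid y - hid z) *m y.2) <= nX * pnorm (y - z) * frob y.2.
  apply: le_trans (frobM _ _) _; rewrite ler_wpM2r ?frob_ge0//.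
  apply: le_trans (hid_lip _ _) _; rewrite ler_wpM2l ?opnorm_ge0//.
  exact: (frob1_le (y - z)).
have h2 : frob (hid z *m (y.2 - z.2)) <= nX * frob z.1 * pnorm (y - z).
  apply: le_trans (frobM _ _) _; apply: ler_pM; rewrite ?frob_ge0//.
    exact: frob_hid.
  exact: (frob2_le (y - z)).
lra.
Qed.

Lemma half_sqr_diff m n (A B : 'M[R]_(m, n)) :
  2^-1 * frob A ^+ 2 - 2^-1 * frob B ^+ 2
    = fdot B (A - B) + 2^-1 * frob (A - B) ^+ 2.
Proof.
rewrite -[A in LHS](subrK B) !frob_sqr !fdotDl !fdotDr !fdotNl !fdotNr.
rewrite (fdotC B A); lra.
Qed.

Lemma loss_lipschitz B : 0 <= B -> exists2 K, 0 < K & forall y z,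
  pnorm y <= B -> pnorm z <= B -> `|L y - L z| <= K * pnorm (y - z).
Proof.
move=> B0; set r := nX * (B + B); set r1 := r * B + frob Y.
have r0 : 0 <= r by rewrite mulr_ge0 ?opnorm_ge0//; lra.
have r10 : 0 <= r1 by rewrite addr_ge0 ?frob_ge0// mulr_ge0.
exists (r1 * r + r * r * B + 1).
  by have := mulr_ge0 r10 r0; have := mulr_ge0 (mulr_ge0 r0 r0) B0; lra.
move=> y z yB zB.
have rl (a b : P) : pnorm a <= B -> pnorm b <= B ->
    frob (res a - res b) <= r * pnorm (a - b).
  move=> aB bB; apply: le_trans (res_lip _ _) _.
  rewrite ler_wpM2r ?pnorm_ge0// ler_wpM2l ?opnorm_ge0//.
  by have := frob2_le a; have := frob1_le b; lra.
have rb (a : P) : pnorm a <= B -> frob (res a) <= r1.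
  move=> aB; rewrite -[res a](subrK (res 0)) (le_trans (frobD _ _))//.
  have := rl a 0 aB; rewrite pnorm0 subr0 => /(_ B0).
  have -> : res 0 = - Y by rewrite /res /= mulmx0 sub0r.
  rewrite frobN /r1; have := ler_wpM2l r0 aB; lra.
have half (a b : P) : pnorm a <= B -> pnorm b <= B ->
    L a - L b <= (r1 * r + r * r * B + 1) * pnorm (a - b).
  move=> aB bB; rewrite !lossE half_sqr_diff.
  have pab : pnorm (a - b) <= B + B.
    by apply: le_trans (pnormD _ _) _; rewrite pnormN lerD.
  have e1 := rl a b aB bB.
  have := fdot_CS (res b) (res a - res b).
  have : frob (res b) * frob (res a - res b) <= r1 * (r * pnorm (a - b)).
    by apply: ler_pM; rewrite ?frob_ge0// rb.
  have : frob (res a - res b) ^+ 2 <= (r * pnorm (a - b)) * (r * (B + B)).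
    rewrite expr2; apply: ler_pM; rewrite ?frob_ge0//.
    by apply: le_trans e1 _; rewrite ler_wpM2l.
  have := pnorm_ge0 (a - b); lra.
by rewrite ler_norml; apply/andP; split; [|exact: half];
  have := half z y zB yB; rewrite (pnormBC z y); lra.
Qed.

(** Such a direction leaves a zero preactivation of th unchanged from every base point, not only
    from th, so that no kink is crossed near th. *)
Definition tame th v := forall i j,
  (X *m th.1) i j = 0 -> (X *m v.1) i j = 0.

(** The derivative of the hidden layer in a tame direction. At a zero preactivation of th the value
    0 is then right on both sides of the kink. *)
Definition active th v : 'M[R]_(N, d1) :=
  \matrix_(i, j) if 0 < (X *m th.1) i j then (X *m v.1) i j else 0.

Definition ldir th v := fdot (res th) (active th v *m th.2 + hid th *m v.2).

Lemma nonzero_gap m n (A : 'M[R]_(m, n)) :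
  exists2 g, 0 < g & forall i j, A i j != 0 -> g <= `|A i j|.
Proof.
exists (\big[Num.min/1]_(k : 'I_m * 'I_n | A k.1 k.2 != 0) `|A k.1 k.2|).
  by apply: lt_bigmin => // k k0; rewrite normr_gt0.
move=> i j Aij.
exact: (bigmin_le_cond 1 (fun k : 'I_m * 'I_n => `|A k.1 k.2|) (j := (i, j))).
Qed.

(** Nonzero preactivations of th exceed a gap g and keep their sign as long as y - th and s v move
    them by less than g; zero ones are not moved by v at all. Hence the hidden layer is exactly
    affine in s. *)
Lemma hid_tame th v : tame th v -> exists2 r, 0 < r & forall y s,
  pnorm (y - th) < r -> `|s| < r -> hid (y + s *: v) = hid y + s *: active th v.
Proof.
move=> tv; have [g g0 hg] := nonzero_gap (X *m th.1).
set k := nX * (1 + frob v.1) + 1.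
have k0 : 0 < k.
  by rewrite ltr_wpDl// mulr_ge0 ?opnorm_ge0// addr_ge0 ?frob_ge0.
exists (g / k); first by rewrite divr_gt0.
move=> y s yr sr; apply/matrixP => i j.
have hidE w : hid w i j = Num.max ((X *m w.1) i j) 0 by rewrite mxE.
rewrite hidE [RHS]mxE hidE [(s *: active th v) i j]mxE [active th v i j]mxE.
have -> : (X *m (y + s *: v).1) i j = (X *m y.1) i j + s * (X *m v.1) i j.
  by rewrite /= mulmxDr -scalemxAr !mxE.
have b1 : `|(X *m y.1) i j - (X *m th.1) i j| <= nX * pnorm (y - th).
  have -> : (X *m y.1) i j - (X *m th.1) i j = (X *m (y - th).1) i j.
    by rewrite /= mulmxBr !mxE.
  apply: le_trans (frob_entry _ _ _) _; apply: le_trans (opnormM _ _) _.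
  by rewrite ler_wpM2l ?opnorm_ge0// frob1_le.
have b2 : `|s * (X *m v.1) i j| <= `|s| * (nX * frob v.1).
  rewrite normrM ler_wpM2l//; apply: le_trans (frob_entry _ _ _) _.
  exact: opnormM.
have [z0|z0] := eqVneq ((X *m th.1) i j) 0.
  by rewrite z0 ltxx (tv _ _ z0) !mulr0 !addr0.
have := hg i j z0; set Z := (X *m th.1) i j in b1 z0 *.
set Zy := (X *m y.1) i j in b1 *; set Zv := s * (X *m v.1) i j in b2 *.
move=> gZ.
have sm : nX * pnorm (y - th) + `|s| * (nX * frob v.1) < g.
  have X0 := opnorm_ge0 X; have v0 := frob_ge0 v.1.
  have gk : 0 < g / k by rewrite divr_gt0.
  have : nX * pnorm (y - th) <= nX * (g / k) by rewrite ler_wpM2l// ltW.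
  have : `|s| * (nX * frob v.1) <= g / k * (nX * frob v.1).
    by rewrite ler_wpM2r ?mulr_ge0// ltW.
  have : g / k * k = g by rewrite divfK// gt_eqF.
  rewrite {2}/k; lra.
move: b1 b2; rewrite !ler_norml => /andP[b1 b1'] /andP[b2 b2'].
case: (ltP 0 Z) => Z0.
  rewrite gtr0_norm// in gZ.
  by rewrite !max_l//; lra.
rewrite ler0_norm// in gZ.
by rewrite mulr0 addr0 !max_r//; lra.
Qed.

(** Along v the residual is exactly quadratic in s, with coefficients Lipschitz in the base point.
    Uniformity in y is essential: the Clarke quotient is taken at points y near th, where other
    preactivations may vanish. *)
Lemma tame_quotient th v : tame th v -> exists C r, [/\ 0 < C, 0 < r &
  forall y s, pnorm (y - th) < r -> `|s| < r -> s != 0 ->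
    `|(L (y + s *: v) - L y) / s - ldir th v| <= C * (pnorm (y - th) + `|s|)].
Proof.
move=> tv; have [r0 r00 hr] := hid_tame tv.
set G := active th v.
set cR := nX * (frob th.2 + 1 + frob th.1).
set cK := frob G + nX * frob v.2.
set Kt := G *m th.2 + hid th *m v.2.
set K2 := G *m v.2.
have X0 := opnorm_ge0 X.
have cR0 : 0 <= cR by rewrite mulr_ge0// !addr_ge0 ?frob_ge0.
have cK0 : 0 <= cK by rewrite addr_ge0 ?frob_ge0 ?mulr_ge0 ?frob_ge0.
set kk := frob Kt + cK; have kk0 : 0 <= kk by rewrite addr_ge0 ?frob_ge0.
set rr := frob (res th) + cR; have rr0 : 0 <= rr by rewrite addr_ge0 ?frob_ge0.
have T1 := frob_ge0 (res th); have T2 := frob_ge0 K2.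
exists (cR * kk + frob (res th) * cK + rr * frob K2 + (kk + frob K2) ^+ 2 + 1),
  (Num.min r0 1); split.
- have := mulr_ge0 cR0 kk0; have := mulr_ge0 T1 cK0; have := mulr_ge0 rr0 T2.
  have := sqr_ge0 (kk + frob K2); lra.
- by rewrite lt_min r00 ltr01.
move=> y s; rewrite !lt_min => /andP[yr y1] /andP[sr s1] s0.
set D := pnorm (y - th) in yr y1 *.
have D0 : 0 <= D by exact: pnorm_ge0.
set Ky := G *m y.2 + hid y *m v.2.
have eK : frob (Ky - Kt) <= cK * D.
  have -> : Ky - Kt = G *m (y.2 - th.2) + (hid y - hid th) *m v.2.
    by rewrite mulmxBr mulmxBl /Ky /Kt opprD addrACA.
  apply: le_trans (frobD _ _) _.
  have : frob (G *m (y.2 - th.2)) <= frob G * D.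
    apply: le_trans (frobM _ _) _; rewrite ler_wpM2l ?frob_ge0//.
    exact: (frob2_le (y - th)).
  have : frob ((hid y - hid th) *m v.2) <= nX * D * frob v.2.
    apply: le_trans (frobM _ _) _; rewrite ler_wpM2r ?frob_ge0//.
    apply: le_trans (hid_lip _ _) _; rewrite ler_wpM2l//.
    exact: (frob1_le (y - th)).
  by rewrite /cK; lra.
have eR : frob (res y - res th) <= cR * D.
  apply: le_trans (res_lip _ _) _; rewrite -/D ler_wpM2r// ler_wpM2l//.
  have : frob y.2 <= frob th.2 + D.
    rewrite -[y.2](subrK th.2) addrC (le_trans (frobD _ _))// lerD2l.
    exact: (frob2_le (y - th)).
  lra.
have bK : frob Ky <= kk.
  rewrite -[Ky](subrK Kt) addrC (le_trans (frobD _ _))// lerD2l.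
  by apply: le_trans eK _; rewrite ler_piMr// ltW.
have bR : frob (res y) <= rr.
  rewrite -[res y](subrK (res th)) addrC (le_trans (frobD _ _))// lerD2l.
  by apply: le_trans eR _; rewrite ler_piMr// ltW.
have E : res (y + s *: v) - res y = s *: (Ky + s *: K2).
  have aux (a b c d e : 'M[R]_(N, d2)) :
      a + b + (c + d) - e - (a - e) = c + b + d.
    by apply/matrixP => i j; rewrite !mxE; ring.
  rewrite /res (hr y s yr sr) /= mulmxDl !mulmxDr -!scalemxAl -!scalemxAr.
  by rewrite aux /Ky /K2 !scalerDr.
have -> : ldir th v = fdot (res th) Kt by [].
rewrite !lossE half_sqr_diff E fdotZr frobZ exprMn (real_normK (num_real s)).
have -> : (s * fdot (res y) (Ky + s *: K2) +
    2^-1 * (s ^+ 2 * frob (Ky + s *: K2) ^+ 2)) / s - fdot (res th) Kt =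
    fdot (res y - res th) Ky + fdot (res th) (Ky - Kt) + s * fdot (res y) K2
    + s * (2^-1 * frob (Ky + s *: K2) ^+ 2).
  move: (frob _) (res y) (res th) => F ry rt.
  clearbody Ky Kt K2; rewrite !fdotDl !fdotDr !fdotNl !fdotNr !fdotZr; field.
  exact: s0.
have fCS m n (A B : 'M[R]_(m, n)) : `|fdot A B| <= frob A * frob B.
  rewrite ler_norml fdot_CS andbT lerNl -fdotNl.
  by apply: le_trans (fdot_CS _ _) _; rewrite frobN.
have i1 : `|fdot (res y - res th) Ky| <= cR * D * kk.
  by apply: le_trans (fCS _ _ _ _) _; apply: ler_pM; rewrite ?frob_ge0.
have i2 : `|fdot (res th) (Ky - Kt)| <= frob (res th) * (cK * D).
  by apply: le_trans (fCS _ _ _ _) _; rewrite ler_wpM2l.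
have i3 : `|s * fdot (res y) K2| <= `|s| * (rr * frob K2).
  rewrite normrM ler_wpM2l//; apply: le_trans (fCS _ _ _ _) _.
  by rewrite ler_wpM2r.
have i4 : `|s * (2^-1 * frob (Ky + s *: K2) ^+ 2)| <= `|s| * (kk + frob K2) ^+ 2.
  rewrite normrM ler_wpM2l// ger0_norm; last by rewrite mulr_ge0 ?sqr_ge0.
  have : frob (Ky + s *: K2) ^+ 2 <= (kk + frob K2) ^+ 2.
    rewrite ler_pXn2r// ?nnegrE ?frob_ge0 ?(addr_ge0 kk0 T2)//.
    apply: le_trans (frobD _ _) _; apply: lerD => //.
    by rewrite frobZ ler_piMl// ltW.
  have := sqr_ge0 (frob (Ky + s *: K2)); lra.
apply: le_trans (ler_normD _ _) _.
apply: (@le_trans _ _ (cR * D * kk + frob (res th) * (cK * D) +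
  `|s| * (rr * frob K2) + `|s| * (kk + frob K2) ^+ 2)).
  apply: lerD => //; apply: le_trans (ler_normD _ _) _.
  apply: lerD => //; apply: le_trans (ler_normD _ _) _.
  exact: lerD.
have p1 : 0 <= `|s| * (cR * kk + frob (res th) * cK).
  by rewrite mulr_ge0// addr_ge0// mulr_ge0.
have p2 : 0 <= D * (rr * frob K2 + (kk + frob K2) ^+ 2).
  by rewrite mulr_ge0// addr_ge0 ?sqr_ge0// mulr_ge0.
have := normr_ge0 s; lra.
Qed.

(** Difference quotients converge to [ldir], so the pairing is at most [ldir]. Tameness and the
    formula are symmetric under v -> -v, which yields the reverse inequality. *)
Lemma clarke_tame th v xi : clarke_subdiff L th xi -> tame th v ->
  pdot xi v = ldir th v.
Proof.
have half w : clarke_subdiff L th xi -> tame th w -> pdot xi w <= ldir th w.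
  move=> cl tw; have [C [r [C0 r0 hC]]] := tame_quotient tw.
  apply/ler_addgt0Pr => e e0.
  pose dl := Num.min r (e / (4 * C)).
  have dl0 : 0 < dl by rewrite lt_min r0 divr_gt0// mulr_gt0.
  have e2 : 0 < e / 2 by rewrite divr_gt0.
  have [y [t [yd t0 td h]]] := cl w (e / 2) e2 dl dl0.
  move: yd td; rewrite !lt_min => /andP[yr ye] /andP[tr te].
  have := hC y t yr; rewrite gtr0_norm// gt_eqF// => /(_ tr isT).
  rewrite ler_norml => /andP[_].
  move: ye te; rewrite !ltr_pdivlMr ?mulr_gt0//.
  move: h; set q := (_ / t); lra.
move=> cl tv; apply/eqP; rewrite eq_le half//=.
have tNv : tame th (- v).
  by move=> i j /tv e; rewrite /= mulmxN mxE e oppr0.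
have := half _ cl tNv; rewrite pdotNr.
have -> : ldir th (- v) = - ldir th v; last by rewrite lerN2.
have aE : active th (- v) = - active th v.
  apply/matrixP => i j; rewrite [LHS]mxE [RHS]mxE [active th v i j]mxE.
  by case: ifP => _; rewrite ?oppr0// /= mulmxN mxE.
by rewrite /ldir aE /= mulNmx mulmxN -opprD fdotNr.
Qed.

(** A direction in W may cross kinks, so only an inequality is available. Testing with (xi.1, 0)
    bounds |xi.1|^2 by |xi.1| times the Lipschitz constant of the loss in W at th. *)
Lemma clarke_fst th xi : clarke_subdiff L th xi ->
  frob xi.1 <= nX * frob th.2 * frob (res th).
Proof.
move=> cl; have X0 := opnorm_ge0 X.
set m := nX * frob th.2 * frob (res th).
have m0 : 0 <= m by rewrite !mulr_ge0 ?frob_ge0.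
suff h : frob xi.1 * frob xi.1 <= frob xi.1 * m.
  have [->//|x0] := eqVneq (frob xi.1) 0.
  by rewrite -(@ler_pM2l _ (frob xi.1))// lt_def x0 frob_ge0.
set w := frob xi.1; have w0 : 0 <= w by exact: frob_ge0.
pose v : P := (xi.1, 0).
have pv : pdot xi v = w * w.
  have z2 : fdot xi.2 0 = 0 by rewrite fdotC fdot0l.
  by rewrite pdotE /= z2 addr0 -expr2 /w frob_sqr.
rewrite -pv; apply/ler_addgt0Pr => e e0.
set cR := nX * (frob th.2 + 1 + frob th.1).
have cR0 : 0 <= cR by rewrite mulr_ge0// !addr_ge0 ?frob_ge0.
set a := nX * w.
have a0 : 0 <= a by rewrite mulr_ge0.
have V0 := frob_ge0 th.2; have R0 := frob_ge0 (res th).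
(* C collects the errors of replacing y by th, of order |y - th|, and of the quadratic term, of
   order t; [dl] then keeps them below e/2. *)
pose C := a * (frob (res th) + (frob th.2 + 1) * (cR + a * (frob th.2 + 1))) + 1.
have C0 : 0 < C.
  rewrite ltr_wpDl// mulr_ge0// addr_ge0// mulr_ge0 ?addr_ge0//.
  by rewrite mulr_ge0 ?addr_ge0.
pose dl := Num.min 1 (e / (4 * C)).
have dl0 : 0 < dl by rewrite lt_min ltr01 divr_gt0// mulr_gt0.
have e2 : 0 < e / 2 by rewrite divr_gt0.
have [y [t [yd t0 td h]]] := cl v (e / 2) e2 dl dl0.
move: yd td; rewrite !lt_min => /andP[y1 ye] /andP[t1 te].
set D := pnorm (y - th) in y1 ye; have D0 : 0 <= D by exact: pnorm_ge0.
set A := res (y + t *: v) - res y.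
have bV : frob y.2 <= frob th.2 + D.
  rewrite -[y.2](subrK th.2) addrC (le_trans (frobD _ _))// lerD2l.
  exact: (frob2_le (y - th)).
have y20 := frob_ge0 y.2.
have bR : frob (res y) <= frob (res th) + cR * D.
  rewrite -[res y](subrK (res th)) addrC (le_trans (frobD _ _))// lerD2l.
  apply: le_trans (res_lip _ _) _; rewrite -/D ler_wpM2r// ler_wpM2l//.
  lra.
have bA : frob A <= t * (a * frob y.2).
  have -> : A = (hid (y + t *: v) - hid y) *m y.2.
    by rewrite /A /res /= scaler0 addr0 opprB addrA subrK mulmxBl.
  apply: le_trans (frobM _ _) _; rewrite mulrA ler_wpM2r//.
  apply: le_trans (hid_lip _ _) _.
  have -> : (y + t *: v).1 - y.1 = t *: xi.1 by rewrite /= addrC addKr.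
  by rewrite frobZ gtr0_norm// mulrCA.
have A0 := frob_ge0 A.
have qb : (L (y + t *: v) - L y) / t <=
    frob (res y) * (a * frob y.2) + t * (a * frob y.2) ^+ 2.
  rewrite ler_pdivrMr// !lossE half_sqr_diff -/A.
  have := fdot_CS (res y) A.
  have : frob (res y) * frob A <= frob (res y) * (t * (a * frob y.2)).
    by rewrite ler_wpM2l// frob_ge0.
  have : frob A ^+ 2 <= (t * (a * frob y.2)) ^+ 2.
    by rewrite ler_pXn2r// nnegrE// ?frob_ge0// (le_trans A0).
  have := sqr_ge0 (t * (a * frob y.2)).
  lra.
apply: (@le_trans _ _ (frob (res y) * (a * frob y.2) + t * (a * frob y.2) ^+ 2 + e / 2)).
  by move: (le_trans h qb); lra.
move: ye te; rewrite !ltr_pdivlMr ?mulr_gt0// => ye te.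
set r := frob (res th) in bR R0 *; set V := frob th.2 in bV V0 *.
have s1 : frob (res y) * (a * frob y.2) <= (r + cR * D) * (a * (V + D)).
  apply: ler_pM; rewrite ?frob_ge0 ?mulr_ge0//.
  by rewrite ler_wpM2l.
have s2 : t * (a * frob y.2) ^+ 2 <= t * (a * (V + 1)) ^+ 2.
  have q1 : 0 <= a * frob y.2 by exact: mulr_ge0.
  have q2 : 0 <= a * (V + 1) by apply: mulr_ge0 => //; lra.
  rewrite ler_pM2l// ler_pXn2r ?nnegrE//.
  by rewrite ler_wpM2l// (le_trans bV)// lerD2l ltW.
have s3 : cR * D * (a * (V + D)) <= cR * D * (a * (V + 1)).
  apply: (ler_wpM2l (mulr_ge0 cR0 D0)); rewrite ler_wpM2l// lerD2l.
  exact: ltW.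
have CE : C = a * r + a * (V + 1) * cR + (a * (V + 1)) ^+ 2 + 1.
  by rewrite /C -/V -/r; ring.
have mE : w * m = a * V * r by rewrite /m /a -/V -/r; ring.
have aV : 0 <= a * (V + 1) by apply: mulr_ge0 => //; lra.
have p1 : 0 <= t * (a * r + a * (V + 1) * cR + 1).
  apply: mulr_ge0; first exact: ltW.
  by have := mulr_ge0 a0 R0; have := mulr_ge0 aV cR0; lra.
have p2 : 0 <= D * ((a * (V + 1)) ^+ 2 + 1).
  by apply: mulr_ge0 => //; have := sqr_ge0 (a * (V + 1)); lra.
rewrite CE in ye te; rewrite mE; clear - s1 s2 s3 p1 p2 ye te e0; lra.
Qed.

(** Directions in V leave all preactivations fixed, so they are tame and the V-component is the
    classical gradient. *)
Lemma clarke_snd th xi : clarke_subdiff L th xi ->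
  xi.2 = (hid th)^T *m res th.
Proof.
move=> cl; set w := (hid th)^T *m res th.
have tv : tame th (0, xi.2 - w) by move=> i j _; rewrite /= mulmx0 mxE.
have := clarke_tame cl tv; rewrite pdotE /ldir /=.
have -> : active th (0, xi.2 - w) = 0.
  apply/matrixP => i j; rewrite [LHS]mxE [RHS]mxE.
  by case: ifP => // _; rewrite /= mulmx0 mxE.
have z1 : fdot xi.1 0 = 0 by rewrite fdotC fdot0l.
rewrite mul0mx add0r z1 add0r fdotC.
rewrite [RHS]fdotC fdot_mull -/w => e.
apply/eqP; rewrite -subr_eq0; apply/eqP/frob_eq0/eqP.
by rewrite -sqrf_eq0 frob_sqr fdotDr fdotNr e subrr.
Qed.

End Loss.

(** * Differentiation along a solution *)

Section RealDerivative.
Context {R : realType}.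
Notation mu := (@lebesgue_measure R).

Lemma is_deriveP (f : R -> R) (x l : R) : is_derive x 1 f l <->
  (forall e, 0 < e -> exists2 d, 0 < d & forall h, `|h| < d ->
    `|f (x + h) - f x - h * l| <= e * `|h|).
Proof.
split=> [[df dl] e e0|H].
  have /cvgrPdist_le/(_ e e0) :
    h^-1 *: ((f \o shift x) (h *: 1) - f x) @[h --> 0^'] --> l by rewrite -dl.
  move=> /nbhs_ballP [d /= d0 hd]; exists d => // h hlt.
  have [->|h0] := eqVneq h 0.
    by rewrite addr0 subrr mul0r subrr normr0 mulr0.
  have := hd h; rewrite /ball /= sub0r normrN => /(_ hlt h0).
  rewrite /= [h *: 1]mulr1 (addrC h x) => hh.
  have -> : f (x + h) - f x - h * l = (- h) * (l - h^-1 *: (f (x + h) - f x)).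
    by rewrite /GRing.scale /=; field.
  by rewrite normrM normrN mulrC ler_wpM2r.
have cv : h^-1 *: ((f \o shift x) (h *: 1) - f x) @[h --> 0^'] --> l.
  apply/cvgrPdist_le => e e0; have [d d0 hd] := H e e0.
  apply/nbhs_ballP; exists d => //= h; rewrite /ball /= sub0r normrN => hlt h0.
  rewrite [h *: 1]mulr1 (addrC h x) distrC.
  have := hd h hlt.
  have -> : f (x + h) - f x - h * l = h * (h^-1 *: (f (x + h) - f x) - l).
    by rewrite /GRing.scale /=; field.
  by rewrite normrM mulrC ler_pM2r ?normr_gt0.
have dx : derivable f x 1 by apply/cvg_ex; exists l.
by apply: DeriveDef => //; exact: cvg_lim cv.
Qed.

(** The expansions at x towards s and towards t combine into one for the increment over [s, t]; f
    and h each use half of the tolerance. *)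
Lemma abs_cont_derive_le (f h : R -> R) (a b : R) (E : set R) : a <= b ->
  abs_cont_real a b f ->
  (forall s t, a <= s -> s <= t -> t <= b -> h s <= h t) ->
  mu.-negligible E ->
  (forall x, a <= x -> x <= b -> ~ E x -> exists l l',
    [/\ is_derive x 1 f l, is_derive x 1 h l' & l <= l']) ->
  f b - f a <= h b - h a.
Proof.
move=> ab acf hh nE loc; apply: (abs_cont_ae_le ab acf hh nE).
move=> x ax xb nEx e e0.
have [l [l' [/is_deriveP df /is_deriveP dh ll']]] := loc x ax xb nEx.
have e2 : 0 < e / 2 by rewrite divr_gt0.
have [d1 d10 h1] := df _ e2; have [d2 d20 h2] := dh _ e2.
exists (Num.min d1 d2); first by rewrite lt_min d10.
move=> s t as_ sx xt tb; rewrite !lt_min => /andP[sd1 sd2] /andP[td1 td2].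
have n1 : `|s - x| = x - s by rewrite distrC ger0_norm// subr_ge0.
have n2 : `|t - x| = t - x by rewrite ger0_norm// subr_ge0.
have := h1 (s - x); have := h1 (t - x); have := h2 (s - x); have := h2 (t - x).
rewrite n1 n2 (addrC x (s - x)) (addrC x (t - x)) !subrK.
move=> /(_ td2) + /(_ sd2) + /(_ td1) + /(_ sd1).
rewrite !ler_norml => /andP[a1 a2] /andP[b1 b2] /andP[c1 c2] /andP[f1 f2].
have : l * (t - s) <= l' * (t - s).
  by rewrite ler_wpM2r// subr_ge0 (le_trans sx).
lra.
Qed.

(** A simple zero is the only zero in some interval with rational endpoints. Each such interval
    contributes at most one point, and there are countably many. *)
Lemma negligible_simple_zeros (z : R -> R) :
  mu.-negligible [set x | z x = 0 /\ exists2 l, l != 0 & is_derive x 1 z l].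
Proof.
pose S (pq : R * R) := [set x | [/\ pq.1 < x, x < pq.2, z x = 0 &
  forall s, pq.1 < s -> s < pq.2 -> z s = 0 -> s = x]].
have nS pq : mu.-negligible (S pq).
  have [[x Sx]|nx] := pselect (exists x, S pq x); last first.
    by apply: negligibleS (negligible_set0 _) => x Sx; apply: nx; exists x.
  have : mu.-negligible [set x].
    apply/negligibleP; first exact: measurable_set1.
    exact: lebesgue_measure_set1.
  apply: negligibleS => y Sy; have [_ _ _] := Sx; apply; by have [] := Sy.
pose F n := if (unpickle n : option (rat * rat)) is Some pq
  then S (ratr pq.1, ratr pq.2) else set0.
have : mu.-negligible (\bigcup_n F n).
  apply: negligible_bigcup => n; rewrite /F; case: unpickle => [pq|] //.
  exact: negligible_set0.
apply: negligibleS => x /= [zx [l l0 /is_deriveP dz]].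
(* With this tolerance a second zero s near x would give |s - x| |l| <= |s - x| |l| / 2. *)
have l2 : 0 < `|l| / 2 by rewrite divr_gt0// normr_gt0.
have [d d0 hd] := dz _ l2.
have [p /andP[p1 p2]] : exists p : rat, x - d < ratr p < x.
  have [|p] := @rat_in_itvoo R (x - d) x; first by rewrite ltrBlDr ltrDl.
  by rewrite in_itv /=; exists p.
have [q /andP[q1 q2]] : exists q : rat, x < ratr q < x + d.
  have [|q] := @rat_in_itvoo R x (x + d); first by rewrite ltrDl.
  by rewrite in_itv /=; exists q.
have [n nE] : exists n, (unpickle n : option (rat * rat)) = Some (p, q).
  by exists (pickle (p, q)); exact: pickleK.
exists n => //; rewrite /F nE; split=> //= s ps sq zs.
apply: contrapT => /eqP sx.
have := hd (s - x); rewrite (addrC x) subrK zs zx subr0 sub0r normrN normrM.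
rewrite ltr_norml => h.
have : 0 < `|s - x| by rewrite normr_gt0 subr_eq0.
have : `|s - x| * `|l| <= `|l| / 2 * `|s - x|.
  by apply: h; apply/andP; split; lra.
move=> h1 h2; have : 0 < `|s - x| * `|l| by rewrite mulr_gt0// normr_gt0.
lra.
Qed.

End RealDerivative.

(** * The chain rule at almost every time of a solution *)

Section GoodTimes.
Context {R : realType} {N d0 d1 d2 : nat}.
Variables (X : 'M[R]_(N, d0)) (Y : 'M[R]_(N, d2)).
Notation P := (@param R d0 d1 d2).
Notation mu := (@lebesgue_measure R).
Notation nX := (opnorm X).
Notation L := (loss X Y).
Implicit Types (th : R -> P) (v : P).

(** Differentiability at t with derivative v, in the Euclidean norm and with v named, rather than
    through ['D_1], which has a value even where no derivative exists. *)
Definition has_velocity th t v := forall e, 0 < e -> exists2 d, 0 < d &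
  forall h, `|h| < d -> pnorm (th (t + h) - th t - h *: v) <= e * `|h|.

Definition good th t v :=
  [/\ has_velocity th t v, clarke_subdiff L (th t) (- v) & tame X (th t) v].

Lemma is_derive_pdot th t v (p : P) : has_velocity th t v ->
  is_derive t 1 (fun s => pdot (th s) p) (pdot v p).
Proof.
move=> hv; apply/is_deriveP => e e0.
have p1 : 0 < pnorm p + 1 by have := pnorm_ge0 p; lra.
have [d d0' hd] := hv (e / (pnorm p + 1)) (divr_gt0 e0 p1).
exists d => // h hlt.
have -> : pdot (th (t + h)) p - pdot (th t) p - h * pdot v p =
    pdot (th (t + h) - th t - h *: v) p.
  by rewrite !pdotBl pdotZl.
have CS w : `|pdot w p| <= pnorm w * pnorm p.
  rewrite ler_norml pdot_CS andbT lerNl -pdotNl.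
  by apply: le_trans (pdot_CS _ _) _; rewrite pnormN.
apply: le_trans (CS _) _.
apply: (@le_trans _ _ (e / (pnorm p + 1) * `|h| * (pnorm p + 1))).
  apply: ler_pM; rewrite ?pnorm_ge0 ?hd//; lra.
by rewrite mulrAC divfK// gt_eqF.
Qed.

(** Writing a preactivation as a pairing with a fixed parameter lets [is_derive_pdot] differentiate
    it. *)
Lemma preactivation_pdot th i j s :
  (X *m (th s).1) i j = pdot (th s) (\matrix_(k, l) (X i k * (l == j)%:R), 0).
Proof.
rewrite pdotE /= [X in _ + X]fdotC fdot0l addr0 mxE; apply: eq_bigr => k _.
rewrite (bigD1 j)//= big1 => [|l lj]; last by rewrite mxE (negbTE lj) !mulr0.
by rewrite mxE eqxx mulr1 addr0 mulrC.
Qed.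

Lemma ae_good (th0 : P) T th : is_solution X Y th0 T th ->
  mu.-negligible [set t | [/\ 0 <= t, (t%:E < T)%E & ~ good th t ('D_1 th t)]].
Proof.
move=> [_ _ nE].
pose Z (ij : 'I_N * 'I_d1) := [set x | (X *m (th x).1) ij.1 ij.2 = 0 /\
  exists2 l, l != 0 & is_derive x 1 (fun s => (X *m (th s).1) ij.1 ij.2) l].
have nZ : mu.-negligible (\big[setU/set0]_(ij : 'I_N * 'I_d1) Z ij).
  elim/big_ind: _ => [|A B nA nB|ij _]; first exact: negligible_set0.
    exact: negligibleU.
  exact: negligible_simple_zeros.
apply: negligibleS (negligibleU nE nZ) => t /= [t0 tT ng].
have [[dt ct]|nd] := pselect (derivable th t 1 /\
  clarke_subdiff L (th t) (- 'D_1 th t)); last by left.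
right.
have hv : has_velocity th t ('D_1 th t) by move=> e e0; exact: derivable_pnorm.
apply: contrapT => nz; apply: ng; split=> // i j z0.
apply/eqP/negP => /negP v0; apply: nz.
rewrite (bigD1 (i, j))//=; left; split=> //=.
exists ((X *m ('D_1 th t).1) i j) => //.
have := is_derive_pdot (\matrix_(k, l) (X i k * (l == j)%:R), 0) hv.
rewrite -(preactivation_pdot (fun=> 'D_1 th t) i j 0).
by under [X in is_derive _ _ X _]funext => s do rewrite -preactivation_pdot.
Qed.

(** Local Lipschitz continuity replaces th (t + h) by th t + h v up to o(h); along the tame line the
    derivative is [ldir], which equals the pairing of v with the subgradient -v. *)
Lemma loss_derive th t v : good th t v ->
  is_derive t 1 (fun s => L (th s)) (- pnorm v ^+ 2).
Proof.
move=> [hv cl tv]; apply/is_deriveP => e e0.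
have lE : ldir X Y (th t) v = - pnorm v ^+ 2.
  by rewrite -(clarke_tame cl tv) pdotNl pnorm_sqr.
have [C [r [C0 r0 hC]]] := tame_quotient Y tv.
pose B := pnorm (th t) + pnorm v + 1.
have v0 := pnorm_ge0 v; have t0 := pnorm_ge0 (th t).
have B0 : 0 <= B by rewrite /B; lra.
have [K K0 hK] := @loss_lipschitz R N d0 d1 d2 X Y B B0.
pose e1 := Num.min 1 (e / (2 * K)).
have e10 : 0 < e1 by rewrite lt_min ltr01 divr_gt0// mulr_gt0.
have [d d0' hd] := hv e1 e10.
exists (Num.min (Num.min d r) (Num.min (e / (2 * C)) (2^-1))).
  by rewrite !lt_min d0' r0 divr_gt0 ?mulr_gt0//= invr_gt0.
move=> h; rewrite !lt_min => /andP[/andP[hd' hr] /andP[he h2]].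
have [->|h0] := eqVneq h 0.
  by rewrite addr0 subrr mul0r subrr normr0 mulr0.
have hp : 0 < `|h| by rewrite normr_gt0.
have := hC (th t) h; rewrite subrr pnorm0 add0r => /(_ r0 hr h0).
rewrite lE => q1.
have e1' := hd h hd'.
have b1 : pnorm (th t + h *: v) <= B.
  apply: le_trans (pnormD _ _) _; rewrite pnormZ.
  have : `|h| * pnorm v <= pnorm v by rewrite ler_piMl//; lra.
  rewrite /B; lra.
have hv1 : pnorm (th (t + h) - (th t + h *: v)) <= e1 * `|h|.
  by rewrite opprD addrA.
have e11 : e1 <= 1 by rewrite ge_min lexx.
have b2 : pnorm (th (t + h)) <= B.
  apply: le_trans (pnorm_leD _ (th t + h *: v)) _.
  apply: (@le_trans _ _ (pnorm (th t) + `|h| * pnorm v + e1 * `|h|)).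
    by apply: lerD => //; apply: le_trans (pnormD _ _) _; rewrite pnormZ.
  have : `|h| * pnorm v <= pnorm v by rewrite ler_piMl//; lra.
  have : e1 * `|h| <= 1 by rewrite mulr_ile1// ?ltW//; lra.
  rewrite /B; lra.
have q2 := hK _ _ b2 b1.
have e12 : e1 * (2 * K) <= e.
  by rewrite -ler_pdivlMr ?mulr_gt0// ge_min lexx orbT.
have q3 : K * pnorm (th (t + h) - (th t + h *: v)) <= e / 2 * `|h|.
  apply: le_trans (ler_wpM2l (ltW K0) hv1) _; rewrite mulrA ler_pM2r//; lra.
have q4 : `|L (th t + h *: v) - L (th t) - h * (- pnorm v ^+ 2)| <= e / 2 * `|h|.
  have -> : L (th t + h *: v) - L (th t) - h * (- pnorm v ^+ 2) =
    h * ((L (th t + h *: v) - L (th t)) / h - - pnorm v ^+ 2) by field.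
  rewrite normrM mulrC ler_pM2r//; apply: le_trans q1 _.
  have : `|h| * (2 * C) < e by rewrite -ltr_pdivlMr// mulr_gt0.
  lra.
have -> : L (th (t + h)) - L (th t) - h * (- pnorm v ^+ 2) =
  (L (th (t + h)) - L (th t + h *: v)) +
  (L (th t + h *: v) - L (th t) - h * (- pnorm v ^+ 2)) by ring.
apply: le_trans (ler_normD _ _) _; lra.
Qed.

End GoodTimes.

(** * Absolutely continuous curves in parameter space *)

Section Curves.
Context {R : realType} {d0 d1 d2 : nat}.
Notation P := (@param R d0 d1 d2).
Notation mu := (@lebesgue_measure R).
Implicit Types (th : R -> P) (v : R -> P).

Lemma abs_cont_on_sub (a b a' b' : R) th : a <= a' -> b' <= b ->
  abs_cont_on a b th -> abs_cont_on a' b' th.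
Proof.
move=> aa bb ac e e0; have [dl [dl0 h]] := ac e e0; exists dl; split=> //.
move=> n u w hu hw; apply: h => // k kn; have [h1 [h2 h3]] := hu k kn.
by split; [exact: le_trans h1|split=> //; exact: le_trans bb].
Qed.

Lemma abs_cont_uniform (a b : R) th : abs_cont_on a b th ->
  forall e, 0 < e -> exists2 d, 0 < d & forall s t, a <= s -> s <= t -> t <= b ->
    t - s < d -> pnorm (th t - th s) < e.
Proof.
move=> ac e e0; have [dl [dl0 h]] := ac e e0; exists dl => // s t as_ st tb std.
have := h 1%N (fun=> s) (fun=> t); rewrite !big_ord1; apply=> //.
Qed.

Lemma abs_cont_bounded (a b : R) th : a <= b -> abs_cont_on a b th ->
  exists2 B, 0 <= B & forall t, a <= t -> t <= b -> pnorm (th t) <= B.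
Proof.
move=> ab ac; have [d d0' hd] := abs_cont_uniform ac ltr01.
apply: (@straddle_ind R a b (fun s t => exists2 B, 0 <= B &
  forall x, s <= x -> x <= t -> pnorm (th x) <= B)) => //.
- move=> s t u _ _ _ _ [B1 B10 h1] [B2 B20 h2].
  exists (Num.max B1 B2); first by rewrite le_max B10.
  move=> x sx xu; rewrite le_max; have [xt|/ltW tx] := leP x t.
    by rewrite h1.
  by rewrite h2// orbT.
move=> x ax xb; exists (d / 2); first by rewrite divr_gt0.
move=> s t as_ sx xt tb sd td; exists (pnorm (th x) + 1).
  by have := pnorm_ge0 (th x); lra.
move=> y sy yt; apply: le_trans (pnorm_leD _ (th x)) _; rewrite lerD2l.
have [yx|/ltW xy] := leP y x.
  by rewrite pnormBC; apply/ltW/hd; lra.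
by apply/ltW/hd; lra.
Qed.

Lemma abs_cont_real_lip (a b : R) th (f : R -> R) (K M : R) :
  0 < K -> 0 < M -> abs_cont_on a b th ->
  (forall s t, a <= s -> s <= t -> t <= b ->
    `|f t - f s| <= K * pnorm (th t - th s) + M * (t - s)) ->
  abs_cont_real a b f.
Proof.
move=> K0 M0 ac fK e e0.
have [dl [dl0 h]] := ac (e / (2 * K)) ltac:(by rewrite divr_gt0// mulr_gt0).
exists (Num.min dl (e / (2 * M))); split.
  by rewrite lt_min dl0 divr_gt0// mulr_gt0.
move=> n u w hu hw; rewrite lt_min => /andP[s1 s2].
have := h n u w hu hw s1; rewrite ltr_pdivlMr ?mulr_gt0// => s3.
rewrite ltr_pdivlMr ?mulr_gt0// in s2.
apply: (@le_lt_trans _ _ (K * \sum_(k < n) pnorm (th (w k) - th (u k)) +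
  M * \sum_(k < n) (w k - u k))); last by lra.
rewrite !mulr_sumr -big_split /=; apply: ler_sum => k _.
by have [h1 [h2 h3]] := hu k (ltn_ord k); exact: fK.
Qed.

Lemma abs_cont_pdot (a b : R) th (p : P) : abs_cont_on a b th ->
  abs_cont_real a b (fun t => pdot (th t) p).
Proof.
move=> ac; have p0 := pnorm_ge0 p.
apply: (@abs_cont_real_lip _ _ th _ (pnorm p + 1) 1) => //; first by lra.
move=> s t _ st _; rewrite -pdotBl.
have CS w : `|pdot w p| <= pnorm w * pnorm p.
  rewrite ler_norml pdot_CS andbT lerNl -pdotNl.
  by apply: le_trans (pdot_CS _ _) _; rewrite pnormN.
apply: le_trans (CS _) _; have := pnorm_ge0 (th t - th s); lra.
Qed.

(* [pr] stands for one of the projections (W, 0), (0, V), (W, V). *)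
Lemma displacement_le (pr : P -> P) (a b : R) th v (h h' : R -> R) (E : set R) :
  (forall x y, pdot x (pr y) = pdot (pr x) (pr y)) ->
  a <= b -> abs_cont_on a b th -> mu.-negligible E ->
  (forall t, a <= t -> t <= b -> is_derive t 1 h (h' t)) ->
  (forall s t, a <= s -> s <= t -> t <= b -> h s <= h t) ->
  (forall t, a <= t -> t <= b -> ~ E t ->
    has_velocity th t (v t) /\ pnorm (pr (v t)) <= h' t) ->
  pnorm (pr (th b - th a)) <= h b - h a.
Proof.
move=> hpr ab ac nE dh hh hv.
(* Pairing the curve with its own total displacement makes the claim scalar: it becomes |p|^2 <= |p|
   (h b - h a). *)
set p := pr _; have p0 := pnorm_ge0 p.
have := @abs_cont_derive_le R (fun t => pdot (th t) p) (fun t => pnorm p * h t)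
  a b E ab (abs_cont_pdot p ac).
have hh' s t : a <= s -> s <= t -> t <= b -> pnorm p * h s <= pnorm p * h t.
  by move=> as_ st tb; rewrite ler_wpM2l// hh.
move=> /(_ hh' nE) H.
have {}H : pdot (th b) p - pdot (th a) p <= pnorm p * h b - pnorm p * h a.
  apply: H => t at_ tb nEt; have [hvt ht] := hv t at_ tb nEt.
  exists (pdot (v t) p), (pnorm p * h' t); split.
  - exact: is_derive_pdot.
  - have dht := dh t at_ tb.
    by have := @is_deriveZ _ _ _ h (pnorm p) t 1 (h' t) dht.
  rewrite /p hpr; apply: le_trans (pdot_CS _ _) _.
  by rewrite mulrC ler_wpM2l.
move: H; rewrite -pdotBl /p hpr -/p -pnorm_sqr -mulrBr expr2.
have [->|pn] := eqVneq (pnorm p) 0; last by rewrite ler_pM2l// lt_def pn.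
by rewrite subr_ge0 hh.
Qed.

End Curves.

(** * Loss decay and displacement bounds *)

Section RealLemmas.
Context {R : realType}.

Lemma is_derive_add (f g : R -> R) (x a b : R) : is_derive x 1 f a ->
  is_derive x 1 g b -> is_derive x 1 (fun t => f t + g t) (a + b).
Proof. by move=> df dg; exact: is_deriveD. Qed.

Lemma is_derive_mul (f g : R -> R) (x a b : R) : is_derive x 1 f a ->
  is_derive x 1 g b -> is_derive x 1 (fun t => f t * g t) (a * g x + f x * b).
Proof.
move=> df dg; have := @is_deriveM _ _ f g x 1 a b df dg.
by rewrite addrC [_ *: a]mulrC.
Qed.

Lemma is_derive_exp (f : R -> R) (x a : R) : is_derive x 1 f a ->
  is_derive x 1 (fun t => expR (f t)) (a * expR (f x)).
Proof.
move=> df; rewrite mulrC.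
exact: (@is_derive1_comp R expR f x _ _ (is_derive_expR (f x)) df).
Qed.

Lemma is_derive_const (c x : R) : is_derive x 1 (fun=> c) 0.
Proof. exact: is_derive_cst. Qed.

Lemma is_derive_eq1 (f : R -> R) (x a b : R) :
  is_derive x 1 f a -> a = b -> is_derive x 1 f b.
Proof. by move=> h <-. Qed.

Lemma expR_sub1_le (y : R) : expR y - 1 <= y * expR y.
Proof.
have := expR_ge1Dx (- y); rewrite expRN => h.
have e0 := expR_gt0 y.
have := ler_wpM2r (ltW e0) h; rewrite mulVf ?gt_eqF//; lra.
Qed.

Lemma le_halving (x y c : R) : 0 <= c -> (forall n, x <= y + c / 2 ^+ n) -> x <= y.
Proof.
move=> c0 h; apply/ler_addgt0Pr => e e0.
have [n hn] : exists n, c / 2 ^+ n <= e.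
  exists (Num.bound (c / e)).
  have b1 : c / e < (Num.bound (c / e))%:R by rewrite archi_boundP// divr_ge0// ltW.
  have b2 : (Num.bound (c / e))%:R <= 2 ^+ (Num.bound (c / e)) :> R.
    by rewrite -natrX ler_nat ltnW// ltn_expl.
  rewrite ler_pdivrMr ?exprn_gt0// mulrC -ler_pdivrMr// ltW//.
  exact: lt_le_trans b2.
by apply: le_trans (h n) _; rewrite lerD2l.
Qed.

End RealLemmas.

Section Training.
Context {R : realType} {N d0 d1 d2 : nat}.
Variables (X : 'M[R]_(N, d0)) (Y : 'M[R]_(N, d2)) (th0 : @param R d0 d1 d2).
Notation P := (@param R d0 d1 d2).
Notation mu := (@lebesgue_measure R).
Notation nX := (opnorm X).
Notation L := (loss X Y).
Implicit Types (th : R -> P) (v : R -> P) (E : set R).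

Let a := Num.sqrt (L th0).
Let al := sigma_min (hid X th0)^T.
Let w0 := frob th0.1.
Let v0 := frob th0.2.

Hypothesis al0 : 0 < al.

(** A finite-horizon form with explicit velocity and exceptional set, satisfied by solutions on [0,
    T) and on [0, oo) alike. *)
Definition trajectory b th v E :=
  [/\ abs_cont_on 0 b th, mu.-negligible E,
    (forall t, 0 <= t -> t <= b -> ~ E t -> good X Y th t (v t)) & th 0 = th0].

Lemma trajectory_sub b b' th v E : b' <= b -> trajectory b th v E ->
  trajectory b' th v E.
Proof.
move=> bb [ac nE hE h0]; split=> //; first exact: abs_cont_on_sub ac.
by move=> t t0 tb; apply: hE => //; exact: le_trans bb.
Qed.

(** The margin al / 4 leaves |H^T res| >= (3/4) al |res|, and 2 (3/4)^2 >= 1 preserves the decay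
    rate al^2. *)
Definition close_until b th := forall s, 0 <= s -> s <= b ->
  frob (hid X (th s) - hid X th0) <= al / 4.

Lemma good_speed th t (w : P) : good X Y th t w ->
  frob (hid X (th t) - hid X th0) <= al / 4 ->
  al ^+ 2 * L (th t) <= pnorm w ^+ 2.
Proof.
move=> [_ cl _] cls.
have w2 := clarke_snd cl.
set B := res X Y (th t) in w2; set H := hid X (th t) in w2 cls.
have h1 : al * frob B <= frob ((hid X th0)^T *m B) by exact: sigma_minM.
have h2 : frob ((hid X th0)^T *m B) <= frob (H^T *m B) + al / 4 * frob B.
  have -> : (hid X th0)^T *m B = H^T *m B - (H - hid X th0)^T *m B.
    rewrite -mulmxBl; congr (_ *m _).
    have aux (A1 A2 : 'M[R]_(N, d1)) : A1^T = A2^T - (A2 - A1)^T.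
      by apply/matrixP => i j; rewrite !mxE; ring.
    exact: aux.
  apply: le_trans (frobD _ _) _; rewrite lerD2l frobN.
  apply: le_trans (frobM _ _) _; rewrite frob_trmx ler_wpM2r//.
  exact: frob_ge0.
have h3 : frob (H^T *m B) <= pnorm w.
  by rewrite -w2 frobN; exact: frob2_le.
have h4 : 3 / 4 * al * frob B <= pnorm w by lra.
have B0 := frob_ge0 B.
have : (3 / 4 * al * frob B) ^+ 2 <= pnorm w ^+ 2.
  rewrite ler_pXn2r ?nnegrE ?pnorm_ge0//.
  by rewrite mulr_ge0// mulr_ge0 ?(ltW al0)//; lra.
rewrite lossE -/B.
have := mulr_ge0 (sqr_ge0 al) (sqr_ge0 (frob B)); lra.
Qed.

(** The function L(th t) e^(al^2 t) has nonpositive derivative at good times and is compared with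
    the zero function; most of the proof establishes its absolute continuity. *)
Lemma loss_decay b th v E : 0 <= b -> trajectory b th v E ->
  close_until b th -> L (th b) <= L th0 * expR (- (al ^+ 2 * b)).
Proof.
move=> b0 [ac nE hE h0] cls.
have [B B0 hB] := abs_cont_bounded b0 ac.
have [K K0 hK] := @loss_lipschitz R N d0 d1 d2 X Y B B0.
pose k := al ^+ 2; have k0 : 0 < k by rewrite exprn_gt0.
pose f t := L (th t) * expR (k * t).
pose M := expR (k * b); have M0 : 0 < M by exact: expR_gt0.
pose Lm := L (th 0) + K * (B + B) + 1.
have L00 := loss_ge0 X Y (th 0).
have KB : 0 <= K * (B + B) by rewrite mulr_ge0 ?(ltW K0)//; lra.
have Lm0 : 0 < Lm by rewrite /Lm; lra.
have Lb t : 0 <= t -> t <= b -> L (th t) <= Lm.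
  move=> t0 tb; have := hK _ _ (hB t t0 tb) (hB 0 (lexx _) b0).
  rewrite ler_norml => /andP[_].
  have : K * pnorm (th t - th 0) <= K * (B + B).
    rewrite ler_wpM2l// ?(ltW K0)//; apply: le_trans (pnormD _ _) _.
    by rewrite pnormN lerD// hB.
  rewrite /Lm; lra.
have acf : abs_cont_real 0 b f.
  apply: (@abs_cont_real_lip _ _ _ _ _ _ th f (K * M) (Lm * (M * k))).
  - exact: mulr_gt0.
  - by rewrite !mulr_gt0.
  - exact: ac.
  - move=> s t s0 st tb; have t0 := le_trans s0 st; have sb := le_trans st tb.
    have -> : f t - f s = (L (th t) - L (th s)) * expR (k * t) +
      L (th s) * (expR (k * t) - expR (k * s)) by rewrite /f; ring.
    apply: le_trans (ler_normD _ _) _; apply: lerD.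
      rewrite normrM (ger0_norm (expR_ge0 _)) (mulrAC K M).
      apply: ler_pM; rewrite ?expR_ge0//.
      - by apply: hK; exact: hB.
      - by rewrite ler_expR ler_pM2l.
    have es : expR (k * s) <= expR (k * t) by rewrite ler_expR ler_pM2l.
    rewrite normrM ger0_norm ?loss_ge0// ger0_norm ?subr_ge0//.
    rewrite -[Lm * _ * _]mulrA; apply: ler_pM; rewrite ?loss_ge0 ?subr_ge0 ?Lb//.
    have -> : k * s = k * t + - (k * (t - s)) by ring.
    rewrite expRD; have := expR_ge1Dx (- (k * (t - s))).
    set ee := expR (- _) => h.
    have et : expR (k * t) <= M by rewrite ler_expR ler_pM2l.
    have e0 := expR_gt0 (k * t).
    have : expR (k * t) * (1 - ee) <= expR (k * t) * (k * (t - s)).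
      by rewrite ler_wpM2l// ?(ltW e0)//; lra.
    have : expR (k * t) * (k * (t - s)) <= M * (k * (t - s)).
      by rewrite ler_wpM2r// mulr_ge0 ?(ltW k0)// subr_ge0.
    lra.
have : f b - f 0 <= 0 - 0.
  apply: (@abs_cont_derive_le R f (fun=> 0) 0 b E) => // x x0 xb nEx.
  have gx := hE x x0 xb nEx.
  exists (- pnorm (v x) ^+ 2 * expR (k * x) + L (th x) * (k * expR (k * x))), 0.
  split.
  - apply: is_derive_mul; first exact: loss_derive.
    apply: is_derive_exp.
    apply: is_derive_eq1 (is_derive_mul (is_derive_const k x) (is_derive_id x 1)) _.
    by rewrite mul0r add0r mulr1.
  - exact: is_derive_const.
  - have := good_speed gx (cls x x0 xb); rewrite -/k => h.
    have e0 := expR_gt0 (k * x).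
    have := ler_wpM2r (ltW e0) h; lra.
rewrite subr0 subr_le0 /f mulr0 expR0 mulr1 h0 => h.
by rewrite -/k expRN ler_pdivlMr ?expR_gt0.
Qed.

(** The residual is a square root of the loss, so it decays at half the rate. [g] bounds |X| |res|,
    [r] is its antiderivative vanishing at 0 and [rho] the limit of [r] at infinity, equal to 2 sqrt
    2 |X| a / al^2. *)
Let q := al ^+ 2 / 2.
Let rho := nX * (Num.sqrt 2 * a) / q.
Let g s := nX * (Num.sqrt 2 * a) * expR (- (q * s)).
Let r s := rho * (1 - expR (- (q * s))).

Let q0 : 0 < q. Proof. by rewrite divr_gt0// exprn_gt0. Qed.
Let a0 : 0 <= a. Proof. exact: sqrtr_ge0. Qed.
Let rho0 : 0 <= rho.
Proof. by rewrite /rho divr_ge0 ?(ltW q0)// !mulr_ge0 ?opnorm_ge0 ?sqrtr_ge0. Qed.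
Let w00 : 0 <= w0. Proof. exact: frob_ge0. Qed.
Let v00 : 0 <= v0. Proof. exact: frob_ge0. Qed.
Let g_ge0 s : 0 <= g s.
Proof. by rewrite /g !mulr_ge0 ?opnorm_ge0 ?sqrtr_ge0 ?expR_ge0. Qed.

Let r_le s : r s <= rho.
Proof. by rewrite /r ler_piMr// lerBlDr lerDl expR_ge0. Qed.

Let r00 : r 0 = 0. Proof. by rewrite /r mulr0 oppr0 expR0 subrr mulr0. Qed.

Let r_homo s t : s <= t -> r s <= r t.
Proof. by move=> st; rewrite /r ler_wpM2l// lerB// ler_expR lerN2 ler_pM2l. Qed.

Let r_ge0 s : 0 <= s -> 0 <= r s.
Proof. by move=> s0; rewrite -r00; exact: r_homo. Qed.

Let dr (s : R) : is_derive s 1 r (g s).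
Proof.
have d1' : is_derive s 1 (fun t : R => - q * t) (- q).
  apply: is_derive_eq1 (is_derive_mul (is_derive_const (- q) s) (is_derive_id s 1)) _.
  by rewrite mul0r add0r mulr1.
have := is_derive_mul (is_derive_const rho s)
  (is_derive_add (is_derive_const 1 s)
    (is_derive_mul (is_derive_const (-1) s) (is_derive_exp d1'))).
rewrite (_ : (fun t => _) = r); last first.
  by apply/funext => t; rewrite /r mulN1r mulNr.
move=> h; apply: is_derive_eq1 h _.
have -> : - q * s = - (q * s) by rewrite mulNr.
rewrite /g /rho; field.
by rewrite gt_eqF.
Qed.

Lemma res_decay b th v E : 0 <= b -> trajectory b th v E ->
  close_until b th -> nX * frob (res X Y (th b)) <= g b.
Proof.
move=> b0 tr cls.
have -> : g b = nX * (Num.sqrt 2 * a * expR (- (q * b))) by rewrite /g [RHS]mulrA.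
rewrite ler_wpM2l ?opnorm_ge0// frob_res /a -sqrtrM//.
have -> : expR (- (q * b)) = Num.sqrt (expR (- (al ^+ 2 * b))).
  rewrite -[LHS]ger0_norm ?expR_ge0// -sqrtr_sqr; congr Num.sqrt.
  by rewrite expr2 -expRD; congr expR; rewrite /q; field.
have L20 : 0 <= 2 * L th0 by have := loss_ge0 X Y th0; lra.
rewrite -sqrtrM// ler_wsqrtr//.
by rewrite -mulrA ler_pM2l//; exact: loss_decay tr cls.
Qed.

(** This dominates x cosh z + y sinh z, the exact solution of the coupled linear system; the
    Gaussian factor is what produces the exponential in F. *)
Let Phi (x y z : R) := (x + y * z) * expR (z ^+ 2 / 2).

Let Phi_homo x y z z' : 0 <= x -> 0 <= y -> 0 <= z -> z <= z' ->
  Phi x y z <= Phi x y z'.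
Proof.
move=> x0 y0 z0 zz; rewrite /Phi; apply: ler_pM.
- by rewrite addr_ge0// mulr_ge0.
- exact: expR_ge0.
- by rewrite lerD2l ler_wpM2l.
- rewrite ler_expR ler_pM2r ?invr_gt0// ler_pXn2r ?nnegrE//.
  exact: le_trans zz.
Qed.

Let dPhi x y (s : R) : is_derive s 1 (fun t => Phi x y (r t))
  (g s * (y + (x + y * r s) * r s) * expR (r s ^+ 2 / 2)).
Proof.
have dsq : is_derive s 1 (fun t => r t ^+ 2 / 2) (g s * r s).
  have := is_derive_mul (is_derive_mul (dr s) (dr s)) (is_derive_const (2^-1) s).
  move=> h; apply: is_derive_eq1 h _; lra.
have := is_derive_mul (is_derive_add (is_derive_const x s)
  (is_derive_mul (is_derive_const y s) (dr s))) (is_derive_exp dsq).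
move=> h; apply: is_derive_eq1 h _; ring.
Qed.

(** The weight e^(2r) is chosen so that integrating M e^(2r) against dr costs a factor 1/2, as in a
    weighted-norm contraction. *)
Let dexp2 M (s : R) : is_derive s 1 (fun t => M / 2 * expR (2 * r t)) (g s * (M * expR (2 * r s))).
Proof.
have := is_derive_mul (is_derive_const (M / 2) s)
  (is_derive_exp (is_derive_mul (is_derive_const 2 s) (dr s))).
move=> h; apply: is_derive_eq1 h _; lra.
Qed.

Let exp2_homo M s t : 0 <= M -> s <= t ->
  M / 2 * expR (2 * r s) <= M / 2 * expR (2 * r t).
Proof.
by move=> M0 st; rewrite ler_wpM2l ?divr_ge0// ler_expR ler_pM2l// r_homo.
Qed.

Lemma good_frob1 th t (w : P) : good X Y th t w ->
  frob w.1 <= nX * frob (res X Y (th t)) * frob (th t).2.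
Proof.
move=> [_ cl _]; have := clarke_fst cl; rewrite frobN.
by rewrite mulrAC.
Qed.

Lemma good_frob2 th t (w : P) : good X Y th t w ->
  frob w.2 <= nX * frob (res X Y (th t)) * frob (th t).1.
Proof.
move=> [_ cl _]; have e : - w.2 = _ := clarke_snd cl.
rewrite -[frob w.2]frobN e.
apply: le_trans (frobM _ _) _; rewrite frob_trmx mulrAC ler_wpM2r ?frob_ge0//.
exact: frob_hid.
Qed.

Lemma good_pnorm th t (w : P) : good X Y th t w ->
  pnorm w <= nX * frob (res X Y (th t)) * pnorm (th t).
Proof.
move=> gd; have h1 := good_frob1 gd; have h2 := good_frob2 gd.
set c := nX * _ in h1 h2 *.
have c0 : 0 <= c by rewrite mulr_ge0 ?opnorm_ge0 ?frob_ge0.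
rewrite -(@ler_pXn2r _ 2) ?nnegrE ?pnorm_ge0//; last first.
  by rewrite mulr_ge0 ?pnorm_ge0.
rewrite exprMn !pnorm_sqr !pdotE -!frob_sqr mulrDr -!exprMn addrC.
by apply: lerD; rewrite ler_pXn2r ?nnegrE ?frob_ge0// mulr_ge0 ?frob_ge0.
Qed.

(* One step of a Picard-type contraction: replacing the error term
   [M e^(2r)] in the hypothesis halves it in the conclusion. *)
Lemma displacement_step (pr : P -> P) b th v E (p' A A' B : R -> R) y M :
  0 <= b -> 0 <= M -> trajectory b th v E -> close_until b th ->
  (forall x z, pdot x (pr z) = pdot (pr x) (pr z)) ->
  (forall t, 0 <= t -> t <= b -> good X Y th t (v t) ->
    pnorm (pr (v t)) <= nX * frob (res X Y (th t)) * (y + p' t)) ->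
  (forall t, 0 <= t -> t <= b -> y + p' t <= B t + M * expR (2 * r t)) ->
  (forall t, 0 <= t -> t <= b -> 0 <= y + p' t) ->
  (forall t, 0 <= t -> t <= b -> is_derive t 1 A (A' t)) ->
  (forall s t, 0 <= s -> s <= t -> t <= b -> A s <= A t) ->
  (forall t, 0 <= t -> t <= b -> g t * B t <= A' t) ->
  pnorm (pr (th b - th 0)) <= A b - A 0 + M / 2 * expR (2 * r b).
Proof.
move=> b0 M0 tr cls hpr speed pB p0 dA Ah AB; have [ac nE hE h0] := tr.
have := @displacement_le R d0 d1 d2 pr 0 b th v
  (fun t => A t + M / 2 * expR (2 * r t)) _ E hpr b0 ac nE
  (fun t t0 tb => is_derive_add (dA t t0 tb) (dexp2 M t)).
have hm s t : 0 <= s -> s <= t -> t <= b ->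
    A s + M / 2 * expR (2 * r s) <= A t + M / 2 * expR (2 * r t).
  by move=> s0 st tb; apply: lerD; [exact: Ah|exact: exp2_homo].
move=> /(_ hm) H.
have {}H : pnorm (pr (th b - th 0)) <= A b + M / 2 * expR (2 * r b) -
    (A 0 + M / 2 * expR (2 * r 0)).
  apply: H => t t0 tb nEt; have gd := hE t t0 tb nEt; split; first by case: gd.
  apply: le_trans (speed t t0 tb gd) _.
  have rg : nX * frob (res X Y (th t)) <= g t.
    apply: (res_decay t0 (trajectory_sub tb tr)).
    by move=> z z0 zt; apply: cls => //; exact: le_trans zt tb.
  apply: le_trans (ler_wpM2r (p0 t t0 tb) rg) _.
  apply: le_trans (ler_wpM2l (g_ge0 t) (pB t t0 tb)) _.
  by rewrite mulrDr lerD2r; exact: AB.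
have : 0 <= M / 2 * expR (2 * r 0) by rewrite !mulr_ge0 ?expR_ge0.
lra.
Qed.

(** [S M] is the pair of comparison bounds up to an error M e^(2r). The bound on V improves the one
    on W and conversely, halving M each time, so the error disappears in the limit. *)
Lemma fst_displacement b th v E : 0 <= b -> trajectory b th v E ->
  close_until b th -> frob ((th b).1 - th0.1) <= Phi w0 v0 (r b) - w0.
Proof.
move=> b0 tr cls; have [ac nE hE h0] := tr.
pose p s := frob ((th s).1 - th0.1); pose p' s := frob ((th s).2 - th0.2).
pose S M := forall s, 0 <= s -> s <= b ->
  p s <= Phi w0 v0 (r s) - w0 + M * expR (2 * r s) /\
  p' s <= Phi v0 w0 (r s) - v0 + M * expR (2 * r s).
have Phi0 x y : Phi x y (r 0) = x.
  by rewrite /Phi r00 mulr0 addr0 expr0n mul0r expR0 mulr1.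
have Phi_hom x y s t : 0 <= x -> 0 <= y -> 0 <= s -> s <= t -> 
    Phi x y (r s) <= Phi x y (r t).
  by move=> x0 y0 s0 st; apply: Phi_homo => //; [exact: r_ge0|exact: r_homo].
have gPhi x y s : 0 <= x -> 0 <= y -> 0 <= s -> g s * Phi y x (r s) <=
    g s * (y + (x + y * r s) * r s) * expR (r s ^+ 2 / 2).
  move=> x0 y0 s0; rewrite -[leRHS]mulrA ler_wpM2l//.
  rewrite /Phi ler_wpM2r ?expR_ge0//.
  have := mulr_ge0 y0 (sqr_ge0 (r s)); lra.
pose pr1 (x : P) : P := (x.1, 0); pose pr2 (x : P) : P := (0, x.2).
have hpr1 x y : pdot x (pr1 y) = pdot (pr1 x) (pr1 y).
  by rewrite !pdotE /=; congr (_ + _); rewrite [LHS]fdotC !fdot0l.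
have hpr2 x y : pdot x (pr2 y) = pdot (pr2 x) (pr2 y).
  by rewrite !pdotE /=; congr (_ + _); rewrite [LHS]fdotC !fdot0l.
have npr1 x : pnorm (pr1 x) = frob x.1.
  by rewrite pnormE pdotE /= fdot0l addr0 -frobE.
have npr2 x : pnorm (pr2 x) = frob x.2.
  by rewrite pnormE pdotE /= fdot0l add0r -frobE.
have f1 t : frob (th t).1 <= w0 + p t.
  by rewrite -[(th t).1](subrK th0.1) addrC; exact: frobD.
have f2 t : frob (th t).2 <= v0 + p' t.
  by rewrite -[(th t).2](subrK th0.2) addrC; exact: frobD.
have p0 t : 0 <= p t by exact: frob_ge0.
have p0' t : 0 <= p' t by exact: frob_ge0.
have c0 t : 0 <= nX * frob (res X Y (th t)) by rewrite mulr_ge0 ?opnorm_ge0 ?frob_ge0.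
have step M : 0 <= M -> S M -> S (M / 2).
  move=> M0 SM s s0 sb; have trs := trajectory_sub sb tr.
  have clss : close_until s th.
    by move=> z z0 zs; apply: cls => //; exact: le_trans zs sb.
  split.
  - have := @displacement_step pr1 s th v E p' (fun t => Phi w0 v0 (r t))
      (fun t => g t * (v0 + (w0 + v0 * r t) * r t) * expR (r t ^+ 2 / 2))
      (fun t => Phi v0 w0 (r t)) v0 M s0 M0 trs clss hpr1.
    rewrite npr1 /= Phi0 h0; apply.
    + move=> t t0 ts gd; rewrite npr1; apply: le_trans (good_frob1 gd) _.
      by rewrite ler_wpM2l.
    + by move=> t t0 ts; have [_] := SM t t0 (le_trans ts sb); lra.
    + by move=> t _ _; rewrite addr_ge0.
    + by move=> t _ _; exact: dPhi.
    + by move=> t1 t2 h1 h2 _; exact: Phi_hom.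
    + by move=> t t0 _; exact: gPhi.
  - have := @displacement_step pr2 s th v E p (fun t => Phi v0 w0 (r t))
      (fun t => g t * (w0 + (v0 + w0 * r t) * r t) * expR (r t ^+ 2 / 2))
      (fun t => Phi w0 v0 (r t)) w0 M s0 M0 trs clss hpr2.
    rewrite npr2 /= Phi0 h0; apply.
    + move=> t t0 ts gd; rewrite npr2; apply: le_trans (good_frob2 gd) _.
      by rewrite ler_wpM2l.
    + by move=> t t0 ts; have [] := SM t t0 (le_trans ts sb); lra.
    + by move=> t _ _; rewrite addr_ge0.
    + by move=> t _ _; exact: dPhi.
    + by move=> t1 t2 h1 h2 _; exact: Phi_hom.
    + by move=> t t0 _; exact: gPhi.
have [B B0 hB] := abs_cont_bounded b0 ac.
(* The iteration starts from mere boundedness of the curve on [0, b], since [Phi] is at least its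
   value at 0 and the weight is at least 1. *)
have S0 : S (B + B).
  move=> s s0 sb; have e2 : 1 <= expR (2 * r s).
    by rewrite -expR0 ler_expR mulr_ge0// r_ge0.
  have hx x y : 0 <= x -> 0 <= y -> x <= Phi x y (r s).
    by move=> x0 y0; rewrite -[leLHS](Phi0 x y); exact: Phi_hom.
  have nb : pnorm (th s - th 0) <= B + B.
    by apply: le_trans (pnormD _ _) _; rewrite pnormN lerD// hB.
  have Be : B + B <= (B + B) * expR (2 * r s) by rewrite ler_peMr//; lra.
  rewrite h0 in nb; split.
    by have := hx w0 v0 w00 v00; have := frob1_le (th s - th0); rewrite /p /=; lra.
  by have := hx v0 w0 v00 w00; have := frob2_le (th s - th0); rewrite /p' /=; lra.
have Sn n : S ((B + B) / 2 ^+ n).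
  elim: n => [|n IH]; first by rewrite expr0 divr1.
  rewrite exprSr invfM mulrA; apply: step => //.
  by rewrite divr_ge0 ?exprn_ge0//; lra.
apply: (@le_halving _ _ _ ((B + B) * expR (2 * r b))).
  by rewrite mulr_ge0 ?expR_ge0//; lra.
by move=> n; rewrite mulrAC; have [] := Sn n b b0 (lexx _).
Qed.

(** The same iteration for the single inequality |th'| <= r' |th|, whose comparison solution is
    |th0| e^r. *)
Lemma pnorm_displacement b th v E : 0 <= b -> trajectory b th v E ->
  close_until b th -> pnorm (th b - th0) <= pnorm th0 * (expR (r b) - 1).
Proof.
move=> b0 tr cls; have [ac nE hE h0] := tr.
pose p s := pnorm (th s - th0); set n0 := pnorm th0.
have n00 : 0 <= n0 by exact: pnorm_ge0.
pose A t := n0 * expR (r t).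
have A0 : A 0 = n0 by rewrite /A r00 expR0 mulr1.
have Ah s t : s <= t -> A s <= A t.
  by move=> st; rewrite /A ler_wpM2l// ler_expR r_homo.
have dA (t : R) : is_derive t 1 A (g t * A t).
  have := is_derive_mul (is_derive_const n0 t) (is_derive_exp (dr t)).
  by move=> h; apply: is_derive_eq1 h _; rewrite /A; ring.
pose S M := forall s, 0 <= s -> s <= b -> p s <= A s - n0 + M * expR (2 * r s).
have step M : 0 <= M -> S M -> S (M / 2).
  move=> M0 SM s s0 sb; have trs := trajectory_sub sb tr.
  have clss : close_until s th.
    by move=> z z0 zs; apply: cls => //; exact: le_trans zs sb.
  have := @displacement_step id s th v E p A (fun t => g t * A t) A n0 M s0 M0 trs clss (fun _ _ => erefl).
  rewrite A0 h0; apply.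
  + move=> t t0 ts gd; apply: le_trans (good_pnorm gd) _.
    rewrite ler_wpM2l ?mulr_ge0 ?opnorm_ge0 ?frob_ge0//.
    exact: pnorm_leD.
  + by move=> t t0 ts; have := SM t t0 (le_trans ts sb); lra.
  + by move=> t _ _; rewrite addr_ge0// pnorm_ge0.
  + by move=> t1 t2 _ h _; exact: Ah.
  + by [].
have [B B0 hB] := abs_cont_bounded b0 ac.
have S0 : S (B + B).
  move=> s s0 sb; have e2 : 1 <= expR (2 * r s).
    by rewrite -expR0 ler_expR mulr_ge0// r_ge0.
  have nb : pnorm (th s - th 0) <= B + B.
    by apply: le_trans (pnormD _ _) _; rewrite pnormN lerD// hB.
  have Be : B + B <= (B + B) * expR (2 * r s) by rewrite ler_peMr//; lra.
  have := Ah 0 s s0; rewrite A0 /p; rewrite h0 in nb; lra.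
have Sn n : S ((B + B) / 2 ^+ n).
  elim: n => [|n IH]; first by rewrite expr0 divr1.
  rewrite exprSr invfM mulrA; apply: step => //.
  by rewrite divr_ge0 ?exprn_ge0//; lra.
apply: (@le_halving _ _ _ ((B + B) * expR (2 * r b))).
  by rewrite mulr_ge0 ?expR_ge0//; lra.
move=> n; rewrite mulrAC; have := Sn n b b0 (lexx _).
by rewrite /A /p; lra.
Qed.

Let c1 := 2 * Num.sqrt 2 * nX ^+ 2 * v0.
Let c2 := 2 * nX ^+ 3 * w0.
Let c := nX ^+ 2.
Let u := 4 * nX * a / al ^+ 2.
Let F := (a * c1 / al ^+ 3 + a ^+ 2 * c2 / al ^+ 5) * expR (4 * c * a ^+ 2 / al ^+ 4).

Hypothesis F8 : F < 8^-1.

Let sqrt2_sq : Num.sqrt 2 ^+ 2 = 2 :> R.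
Proof. by rewrite sqr_sqrtr. Qed.

(** At r = rho the terms v0 rho and w0 rho^2/2, multiplied by |X|, are al times the first summand of
    F and 2 al times the second; the common bound is 2 al F. *)
Lemma hid_displacement b th v E : 0 <= b -> trajectory b th v E ->
  close_until b th -> frob (hid X (th b) - hid X th0) <= 2 * al * F.
Proof.
move=> b0 tr cls.
have X0 := opnorm_ge0 X.
apply: le_trans (hid_lip X _ _) _.
apply: le_trans (ler_wpM2l X0 (fst_displacement b0 tr cls)) _.
have rb0 := r_ge0 b0.
have Prho : Phi w0 v0 (r b) <= Phi w0 v0 rho by exact: Phi_homo.
have e0 := expR_gt0 (rho ^+ 2 / 2).
have h1 : w0 * (expR (rho ^+ 2 / 2) - 1) <= w0 * (rho ^+ 2 / 2 * expR (rho ^+ 2 / 2)).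
  by rewrite ler_wpM2l// expR_sub1_le.
have h2 : nX * (Phi w0 v0 (r b) - w0) <=
    nX * (v0 * rho + w0 * (rho ^+ 2 / 2)) * expR (rho ^+ 2 / 2).
  rewrite -mulrA ler_wpM2l//.
  move: Prho; rewrite {2}/Phi; lra.
apply: le_trans h2 _.
have al_neq : al != 0 by rewrite gt_eqF.
have rE : rho ^+ 2 / 2 = 4 * c * a ^+ 2 / al ^+ 4.
  rewrite /rho /q /c !exprMn sqrt2_sq; field.
  exact: al_neq.
have E1 : nX * (v0 * rho) = al * (a * c1 / al ^+ 3).
  rewrite /rho /q /c1; field; exact: al_neq.
have E2 : nX * (w0 * (rho ^+ 2 / 2)) = 2 * al * (a ^+ 2 * c2 / al ^+ 5).
  rewrite rE /c /c2; field; exact: al_neq.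
rewrite mulrDr E1 E2 rE /F [leRHS]mulrA ler_pM2r ?expR_gt0//.
have c10 : 0 <= a * c1 / al ^+ 3.
  rewrite divr_ge0 ?exprn_ge0 ?(ltW al0)// mulr_ge0// /c1.
  by rewrite !mulr_ge0 ?sqrtr_ge0 ?exprn_ge0.
rewrite [leRHS]mulrDr lerD2r; have := mulr_ge0 (ltW al0) c10; lra.
Qed.

Lemma stays_close b th v E : 0 <= b -> trajectory b th v E -> close_until b th.
Proof.
move=> b0 tr; have [ac nE hE h0] := tr.
have X0 := opnorm_ge0 X.
pose gap := al / 4 - 2 * al * F.
have gap0 : 0 < gap by rewrite /gap; have := F8; rewrite -(ltr_pM2l al0); lra.
pose phi s := frob (hid X (th s) - hid X th0).
have phi_lip s t : phi t <= phi s + nX * pnorm (th t - th s).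
  rewrite /phi; set A := hid X (th s).
  have -> : hid X (th t) - hid X th0 = (A - hid X th0) + (hid X (th t) - A).
    by rewrite [RHS]addrC addrA subrK.
  apply: le_trans (frobD _ _) _; rewrite lerD2l.
  apply: le_trans (hid_lip X _ _) _; rewrite ler_wpM2l//.
  exact: (frob1_le (th t - th s)).
have gX : 0 < gap / (nX + 1) by rewrite divr_gt0//; lra.
have [d d0' hd] := abs_cont_uniform ac gX.
pose Q s t := (forall x, 0 <= x -> x <= s -> phi x <= al / 4) ->
  (forall x, 0 <= x -> x <= t -> phi x <= al / 4).
suff : Q 0 b.
  apply=> x x0 x0'; have -> : x = 0 by apply/eqP; rewrite eq_le x0'.
  by rewrite /phi h0 subrr frob0 divr_ge0// ltW.
apply: straddle_ind => //; first by move=> s t z _ _ _ _ h1 h2 /h1/h2.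
move=> x x0 xb; exists (d / 2); first by rewrite divr_gt0.
move=> s t s0 sx xt tb sd td cls y y0 yt.
have [ys|sy] := leP y s; first exact: cls.
have sb : s <= b by lra.
have := hid_displacement s0 (trajectory_sub sb tr) cls; rewrite -/(phi s) => ps.
have : pnorm (th y - th s) < gap / (nX + 1) by apply: hd => //; lra.
rewrite ltr_pdivlMr; last by lra.
have := phi_lip s y; have := pnorm_ge0 (th y - th s); rewrite /gap in gap0 *.
lra.
Qed.

Lemma trajectory_loss b th v E : 0 <= b -> trajectory b th v E ->
  L (th b) <= L th0 * expR (- (b * al ^+ 2)).
Proof.
move=> b0 tr; rewrite [b * _]mulrC; apply: (loss_decay b0 tr).
exact: stays_close tr.
Qed.

Lemma trajectory_pnorm b th v E : 0 <= b -> trajectory b th v E ->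
  pnorm (th b - th0) <= u * pnorm th0 * expR u.
Proof.
move=> b0 tr; have := pnorm_displacement b0 tr (stays_close b0 tr).
have X0 := opnorm_ge0 X.
(* Here u is sqrt 2 times rho, and sqrt 2 is rounded up to 2. *)
have ru : r b <= u.
  apply: le_trans (r_le b) _; rewrite /rho /u /q invfM invrK mulrA.
  rewrite [leLHS]mulrAC ler_wpM2r ?invr_ge0 ?sqr_ge0//.
  have s2 : Num.sqrt 2 <= 2 :> R.
    by rewrite -[leRHS]ger0_norm// -sqrtr_sqr ler_wsqrtr// expr2; lra.
  have := ler_wpM2l (mulr_ge0 X0 a0) s2; lra.
have h1 : expR (r b) - 1 <= u * expR u.
  by apply: le_trans (expR_sub1_le u); rewrite lerD2r ler_expR.
move=> h; apply: le_trans h _; rewrite mulrAC [leRHS]mulrC.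
by rewrite ler_wpM2l ?pnorm_ge0.
Qed.

(** The constant does not depend on b, which is what yields a limit at a finite T. *)
Lemma trajectory_lipschitz b th v E s t : 0 <= s -> s <= t -> t <= b ->
  trajectory b th v E ->
  pnorm (th t - th s) <=
    nX * (Num.sqrt 2 * a) * (pnorm th0 + u * pnorm th0 * expR u) * (t - s).
Proof.
move=> s0 st tb tr; set K := _ * (pnorm th0 + _).
have X0 := opnorm_ge0 X.
have [ac nE hE h0] := tr.
have u0 : 0 <= u by rewrite /u divr_ge0 ?sqr_ge0// !mulr_ge0.
have K0 : 0 <= K.
  apply: mulr_ge0; first by rewrite !mulr_ge0 ?sqrtr_ge0.
  apply: addr_ge0; first exact: pnorm_ge0.
  by apply: mulr_ge0; [apply: mulr_ge0 => //; exact: pnorm_ge0|exact: expR_ge0].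
have := @displacement_le R d0 d1 d2 id s t th v (fun x => K * x) (fun=> K) E.
rewrite -mulrBr; apply=> //.
- exact: abs_cont_on_sub ac.
- move=> x _ _.
  apply: is_derive_eq1 (is_derive_mul (is_derive_const K x) (is_derive_id x 1)) _.
  by rewrite mul0r add0r mulr1.
- by move=> x y _ xy _; rewrite ler_wpM2l.
move=> x sx xt nEx; have x0 := le_trans s0 sx; have xb := le_trans xt tb.
have gd := hE x x0 xb nEx; split; first by case: gd.
apply: le_trans (good_pnorm gd) _; apply: ler_pM; rewrite ?pnorm_ge0//.
- by rewrite mulr_ge0 ?frob_ge0.
- apply: le_trans (res_decay x0 (trajectory_sub xb tr) _) _.
    exact: stays_close (trajectory_sub xb tr).
  rewrite /g ler_piMr ?mulr_ge0 ?sqrtr_ge0// -expR0 ler_expR oppr_le0.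
  by rewrite mulr_ge0// ltW.
apply: le_trans (pnorm_leD _ th0) _; rewrite lerD2l.
exact: trajectory_pnorm (trajectory_sub xb tr).
Qed.

End Training.

(** * Coordinates and limits along ultrafilters *)

Section Coordinates.
Context {R : realType} {d0 d1 d2 : nat}.
Notation P := (@param R d0 d1 d2).
Notation mu := (@lebesgue_measure R).
Notation index := ('I_d0 * 'I_d1 + 'I_d1 * 'I_d2)%type.

Definition coord (k : index) (x : P) : R :=
  match k with inl ij => x.1 ij.1 ij.2 | inr ij => x.2 ij.1 ij.2 end.

Definition of_coord (c : index -> R) : P :=
  (\matrix_(i, j) c (inl (i, j)), \matrix_(i, j) c (inr (i, j))).

Lemma coordK c k : coord k (of_coord c) = c k.
Proof. by case: k => -[i j]; rewrite /= mxE. Qed.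

Lemma coordB k (x y : P) : coord k (x - y) = coord k x - coord k y.
Proof. by case: k => -[i j]; rewrite /= !mxE. Qed.

Lemma coordZ k a (x : P) : coord k (a *: x) = a * coord k x.
Proof. by case: k => -[i j]; rewrite /= !mxE. Qed.

Lemma coord_le_pnorm k (x : P) : `|coord k x| <= pnorm x.
Proof.
case: k => -[i j] /=; apply: le_trans (frob_entry _ _ _) _.
  exact: frob1_le.
exact: frob2_le.
Qed.

Lemma pnorm_le_coord : exists2 C : R, 0 < C & forall (x : P) d, 0 <= d ->
  (forall k, `|coord k x| <= d) -> pnorm x <= C * d.
Proof.
have [C C0 hC] := @pnorm_le_norm R d0 d1 d2.
exists C => // x d d_ge0 h; apply: le_trans (hC x) _; rewrite ler_pM2l//.
have mxle m n (A : 'M[R]_(m, n)) : (forall i j, `|A i j| <= d) -> `|A| <= d.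
  move=> hA; have -> : `|A| = mx_norm A by [].
  by rewrite mx_normrE; apply: bigmax_le => // i _.
rewrite ge_max; apply/andP; split; apply: mxle => i j.
  exact: (h (inl (i, j))).
exact: (h (inr (i, j))).
Qed.

(** Compactness gives a cluster point, and for an ultrafilter a cluster point is a limit, since each
    set or its complement belongs to U. *)
Lemma ultralim_real (U : set_system nat) (u : nat -> R) (M : R) :
  UltraFilter U -> (forall n, `|u n| <= M) ->
  exists l, forall e, 0 < e -> U [set n | `|u n - l| < e].
Proof.
move=> UU uM; have UF : ProperFilter U by exact: ultra_proper.
have uU : (u @ U) `[- M, M]%classic.
  apply: (@filterE _ U) => n; rewrite /= in_itv /= -ler_norml; exact: uM.
have [l [_ cl]] := @segment_compact R (- M) M (u @ U) _ uU.
exists l => e e0.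
have [//|nS] := in_ultra_setVsetC [set n | `|u n - l| < e] UU.
have hU : U (u @^-1` [set x | e <= `|x - l|]).
  by apply: filterS nS => n /= h; rewrite leNgt; apply/negP.
have [x [/= x1 x2]] : [set x | e <= `|x - l|] `&` ball l e !=set0.
  by apply: cl; [exact: hU|exact: nbhsx_ballx].
by move: x2; rewrite /ball /= distrC ltNge x1.
Qed.

Lemma ultralim_param (U : set_system nat) (u : nat -> P) (M : R) :
  UltraFilter U -> (forall n, pnorm (u n) <= M) ->
  exists l, forall e, 0 < e -> U [set n | pnorm (u n - l) < e].
Proof.
move=> UU uM; have UF : ProperFilter U by exact: ultra_proper.
have /choice [c hc] : forall k : index, exists l, forall e, 0 < e ->
    U [set n | `|coord k (u n) - l| < e].
  move=> k; apply: ultralim_real => // n.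
  exact: le_trans (coord_le_pnorm _ _) (uM n).
have [C C0 hC] := pnorm_le_coord.
exists (of_coord c) => e e0.
have e1 : 0 < e / (2 * C) by rewrite divr_gt0// mulr_gt0.
have : U [set n | forall k, `|coord k (u n) - c k| < e / (2 * C)].
  by apply: filter_forall => k; exact: hc.
apply: filterS => n /= hn.
apply: (@le_lt_trans _ _ (C * (e / (2 * C)))).
  by apply: hC => [|k]; [exact: ltW|rewrite coordB coordK ltW].
have -> : C * (e / (2 * C)) = e / 2 by field; rewrite gt_eqF.
by lra.
Qed.

Lemma lipschitz_ae_derivable_param (th : R -> P) (b K : R) : 0 < b ->
  (forall s t, 0 <= s -> s <= t -> t <= b -> pnorm (th t - th s) <= K * (t - s)) ->
  mu.-negligible [set t | [/\ 0 < t, t < b & ~ derivable th t 1]].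
Proof.
move=> b0 hK.
have nk k : mu.-negligible
    [set t | [/\ 0 < t, t < b & ~ derivable (fun s => coord k (th s)) t 1]].
  apply: (@lipschitz_ae_derivable R _ 0 b K b0) => s t s0 st tb.
  rewrite -coordB; apply: le_trans (coord_le_pnorm _ _) _; exact: hK.
have : mu.-negligible (\big[setU/set0]_(k : index)
    [set t | [/\ 0 < t, t < b & ~ derivable (fun s => coord k (th s)) t 1]]).
  elim/big_ind: _ => [|A B nA nB|k _]; [exact: negligible_set0|exact: negligibleU|].
  exact: nk.
apply: negligibleS => t /= [t0 tb nd].
apply: contrapT => hn; apply: nd.
have dk k : derivable (fun s => coord k (th s)) t 1.
  apply: contrapT => ndk; apply: hn; rewrite (bigD1 k)//=; left; split=> //.
pose v := of_coord (fun k => 'D_1 (fun s => coord k (th s)) t).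
have [C C0 hC] := pnorm_le_coord.
apply: (proj1 (@pnorm_derivable R d0 d1 d2 th t v _)) => e e0.
have e1 : 0 < e / C by rewrite divr_gt0.
pose W k : set R := fun h =>
  `|coord k (th (t + h)) - coord k (th t) - h * coord k v| <= e / C * `|h|.
have nk' k : nbhs (0 : R) (W k).
  have /is_deriveP/(_ _ e1) [d dd hd] :
    is_derive t 1 (fun s => coord k (th s)) (coord k v).
    by rewrite coordK; exact: DeriveDef.
  apply/nbhs_ballP; exists d => //= h.
  by rewrite /ball /= sub0r normrN => /hd.
have hW : nbhs (0 : R) [set h | forall k, W k h] by exact: filter_forall nk'.
have [d /= dd hd] := (nbhs_ballP _ _).1 hW.
exists d => // h hlt.
apply: (@le_trans _ _ (C * (e / C * `|h|))).
  apply: hC => [|k]; first by rewrite mulr_ge0// ltW.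
  rewrite !coordB coordZ; apply: hd.
  by rewrite /ball /= sub0r normrN.
by rewrite mulrA [C * _]mulrC divfK// gt_eqF.
Qed.

End Coordinates.

(** * Existence of Clarke gradient flows *)

Section ClarkeFlow.
Context {R : realType} {d0 d1 d2 : nat}.
Notation P := (@param R d0 d1 d2).
Notation mu := (@lebesgue_measure R).
Variable f : P -> R.
Hypothesis f_ge0 : forall x, 0 <= f x.
Hypothesis f_lip : forall B, 0 <= B -> exists2 K, 0 < K & forall y z,
  pnorm y <= B -> pnorm z <= B -> `|f y - f z| <= K * pnorm (y - z).

(** A near-minimizer of the proximal functional that also does not exceed the starting value: the
    tolerance is cut to f y - inf, and if that is zero y itself serves. *)
Lemma proximal_step (h e : R) (y : P) : 0 < h -> 0 < e -> exists y' : P,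
  f y' + pnorm (y' - y) ^+ 2 / (2 * h) <= f y /\
  forall z, f y' + pnorm (y' - y) ^+ 2 / (2 * h) - e <=
    f z + pnorm (z - y) ^+ 2 / (2 * h).
Proof.
move=> h0 e0; pose J z := f z + pnorm (z - y) ^+ 2 / (2 * h).
have J0 z : 0 <= J z.
  by rewrite addr_ge0// divr_ge0 ?sqr_ge0// mulr_ge0// ltW.
have Jy : J y = f y by rewrite /J subrr pnorm0 expr0n mul0r addr0.
pose S := [set J z | z in [set: P]].
have Sinf : has_inf S.
  by split; [exists (J y), y | exists 0 => _ [z _ <-]].
have Slb z : inf S <= J z by apply: ge_inf; [case: Sinf|exists z].
have [lt|ge] := ltP (inf S) (f y).
  have d0' : 0 < Num.min e (f y - inf S) by rewrite lt_min e0 subr_gt0.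
  have [_ [y' _ <-] hy'] := inf_adherent d0' Sinf.
  have m1 : Num.min e (f y - inf S) <= e by rewrite ge_min lexx.
  have m2 : Num.min e (f y - inf S) <= f y - inf S by rewrite ge_min lexx orbT.
  exists y'; split; first by rewrite -/(J y'); lra.
  by move=> z; have := Slb z; rewrite -/(J y') -/(J z); lra.
exists y; rewrite -/(J y) Jy; split=> // z.
by have := Slb z; rewrite -/(J z); lra.
Qed.

(** * The approximate implicit Euler scheme and its limit *)

Section Scheme.
Variable x0 : P.

Let h (n : nat) : R := n.+1%:R^-1.

Let h_gt0 n : 0 < h n. Proof. by rewrite invr_gt0. Qed.

(** Near-minimality is later tested with displacements of size h^2, so the tolerance h^4 is
    negligible against the h^2 scale of that test. *)
Let step (n : nat) (y : P) : P :=
  sval (cid (proximal_step y (h_gt0 n) (exprn_gt0 4 (h_gt0 n)))).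

Let stepP n y : f (step n y) + pnorm (step n y - y) ^+ 2 / (2 * h n) <= f y /\
  forall z, f (step n y) + pnorm (step n y - y) ^+ 2 / (2 * h n) - h n ^+ 4 <=
    f z + pnorm (z - y) ^+ 2 / (2 * h n).
Proof. exact: svalP (cid (proximal_step y _ _)). Qed.

Let y n k := iter k (step n) x0.

(** By D <= h/2 + D^2/(2h), with the last term paid for by the decrease of f. The sum telescopes and
    f >= 0, so the iterates are confined before any Lipschitz constant is available. *)
Let y_step n k : pnorm (y n k.+1 - y n k) <= h n / 2 + (f (y n k) - f (y n k.+1)).
Proof.
have [+ _] := stepP n (y n k); rewrite -/(y n k.+1).
set D := pnorm _; set hn := h n; have hn0 : 0 < hn by exact: h_gt0.
move=> H; have : D <= hn / 2 + D ^+ 2 / (2 * hn); last by lra.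
rewrite -subr_ge0.
have -> : hn / 2 + D ^+ 2 / (2 * hn) - D = (D - hn) ^+ 2 / (2 * hn).
  by field; rewrite gt_eqF.
by rewrite divr_ge0 ?sqr_ge0// mulr_ge0// ltW.
Qed.

Let y_dist0 n k : pnorm (y n k - x0) <= k%:R * h n / 2 + f x0.
Proof.
suff : pnorm (y n k - x0) <= k%:R * h n / 2 + (f x0 - f (y n k)).
  by have := f_ge0 (y n k); lra.
elim: k => [|k IH]; first by rewrite /= subrr pnorm0 mul0r; lra.
apply: le_trans (pnormB_le _ (y n k) _) _.
have := y_step n k; rewrite -[k.+1%:R]natr1; move: IH; lra.
Qed.

(** On the bounded region just obtained, D^2/(2h) <= f(y_k) - f(y_(k+1)) <= K D, hence D <= 2 K h
    for each step. *)
Let y_lip b : 0 <= b -> exists2 K, 0 < K & forall n i j, (i <= j)%N ->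
  j%:R * h n <= b -> pnorm (y n j - y n i) <= K * ((j - i)%:R * h n).
Proof.
move=> b0; pose B := pnorm x0 + b / 2 + f x0.
have B0 : 0 <= B by rewrite !addr_ge0 ?pnorm_ge0// divr_ge0.
have yB n k : k%:R * h n <= b -> pnorm (y n k) <= B.
  move=> kb; apply: le_trans (pnorm_leD _ x0) _.
  have := y_dist0 n k; rewrite /B; lra.
have [K K0 hK] := f_lip B0.
exists (2 * K); first by rewrite mulr_gt0.
have one n k : k.+1%:R * h n <= b ->
    pnorm (y n k.+1 - y n k) <= 2 * K * h n.
  move=> kb; have kb' : k%:R * h n <= b.
    by apply: le_trans kb; rewrite ler_pM2r// ler_nat.
  have [+ _] := stepP n (y n k); rewrite -/(y n k.+1).
  have := hK _ _ (yB n _ kb') (yB n _ kb).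
  rewrite pnormBC; set D := pnorm _; set hn := h n.
  have hn0 : 0 < hn by exact: h_gt0.
  rewrite ler_norml => /andP[_ h1] h2.
  have [->|D0] := eqVneq D 0; first by rewrite !mulr_ge0// ltW.
  have Dp : 0 < D by rewrite lt_def D0 pnorm_ge0.
  have : D ^+ 2 / (2 * hn) <= K * D by lra.
  rewrite ler_pdivrMr ?mulr_gt0// expr2 => h3.
  rewrite -(ler_pM2r Dp); lra.
move=> n i j ij jb; rewrite -(subnK ij).
move: jb; rewrite -{1}(subnK ij); elim: (j - i)%N => [|k IH] jb.
  by rewrite add0n subrr pnorm0 subnn mul0r mulr0.
have jb' : (k + i)%:R * h n <= b.
  by apply: le_trans jb; rewrite ler_pM2r// ler_nat addSn.
have := IH jb'; have := one n (k + i)%N jb; rewrite !addnK addSn => h1 h2.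
apply: le_trans (pnormB_le _ (y n (k + i)) _) _.
by rewrite -[k.+1%:R]natr1; lra.
Qed.

Let idx n (t : R) : nat := Num.truncn (t * n.+1%:R).

Let idx_le n t : 0 <= t -> (idx n t)%:R * h n <= t.
Proof.
by move=> t0; rewrite ler_pdivrMr// /idx truncn_le mulr_ge0.
Qed.

Let idx_gt n t : 0 <= t -> t < (idx n t)%:R * h n + h n.
Proof.
move=> t0; have -> : (idx n t)%:R * h n + h n = (idx n t).+1%:R * h n.
  by rewrite -[in RHS]natr1 mulrDl mul1r.
have /andP[_] : (idx n t)%:R <= t * n.+1%:R < (idx n t).+1%:R.
  by apply: truncn_itv; rewrite mulr_ge0.
by rewrite ltr_pdivlMr.
Qed.

Let idx_homo n s t : s <= t -> (idx n s <= idx n t)%N.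
Proof. by move=> st; apply: le_truncn; rewrite ler_pM2r. Qed.

Let idx0 n : idx n 0 = 0%N. Proof. by rewrite /idx mul0r truncn0. Qed.

(** The piecewise constant interpolation; the absolute value gives it bounded values at negative
    times too, so that the limit is defined on all of R. *)
Let thn n (t : R) := y n (idx n `|t|).

Let thn_bound (t : R) : exists M, forall n, pnorm (thn n t) <= M.
Proof.
exists (pnorm x0 + `|t| / 2 + f x0) => n.
apply: le_trans (pnorm_leD _ x0) _.
have := y_dist0 n (idx n `|t|); have := idx_le n (normr_ge0 t).
rewrite /thn; lra.
Qed.

Let h_small (e : R) : 0 < e -> \forall n \near \oo, h n < e.
Proof. by move=> e0; exact: (near_infty_natSinv_lt (PosNum e0)). Qed.

Let thn_lip b : 0 <= b -> exists2 K, 0 < K & forall n s t, 0 <= s -> s <= t ->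
  t <= b -> pnorm (thn n t - thn n s) <= K * (t - s + h n).
Proof.
move=> b0; have [K K0 hK] := y_lip b0; exists K => // n s t s0 st tb.
have t0 := le_trans s0 st.
rewrite /thn !ger0_norm//.
have ij := idx_homo n st.
apply: le_trans (hK n _ _ ij _) _.
  exact: le_trans (idx_le n t0) tb.
rewrite ler_pM2l// natrB// mulrBl.
have := idx_le n t0; have := idx_gt n s0; lra.
Qed.

(** If the Clarke inequality failed at t in a direction v, all difference quotients near th t would
    be too small. Near-minimality would then force every discrete increment, paired with -v, to be
    too small as well, and summing from t to t + s0 contradicts the velocity d. *)
Lemma clarke_flow_exists : exists th : R -> P,
  [/\ th 0 = x0,
    (forall b, 0 <= b -> exists2 K, 0 < K & forall s t, 0 <= s -> s <= t ->
      t <= b -> pnorm (th t - th s) <= K * (t - s)) &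
    (forall t d, 0 <= t -> has_velocity th t d ->
      clarke_subdiff f (th t) (- d))].
Proof.
have [U [UU Uoo]] := @ultraFilterLemma nat \oo _.
have UF : ProperFilter U by exact: ultra_proper.
have /choice [th hth] : forall t : R, exists l : P, forall e, 0 < e ->
    U [set n | pnorm (thn n t - l) < e].
  by move=> t; have [M hM] := thn_bound t; exact: ultralim_param hM.
have Uh e : 0 < e -> U [set n | h n < e] by move=> e0; apply: Uoo; exact: h_small.
exists th; split.
- apply/eqP; rewrite -subr_eq0; apply/eqP.
  have : pnorm (th 0 - x0) <= 0.
    apply/ler_addgt0Pr => e e0; rewrite add0r.
    have [n /= hn] := filter_ex (hth 0 e e0).
    by move: hn; rewrite /thn normr0 idx0 /= pnormBC => /ltW.
  move=> n0; have : pnorm (th 0 - x0) = 0.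
    by apply/eqP; rewrite eq_le n0 pnorm_ge0.
  move=> n00; have f1 : frob (th 0 - x0).1 = 0.
    apply/eqP; rewrite eq_le frob_ge0 andbT.
    by apply: le_trans (frob1_le _) _; rewrite n00.
  have f2 : frob (th 0 - x0).2 = 0.
    apply/eqP; rewrite eq_le frob_ge0 andbT.
    by apply: le_trans (frob2_le _) _; rewrite n00.
  rewrite [LHS]surjective_pairing (frob_eq0 f1) (frob_eq0 f2); reflexivity.
- move=> b b0; have [K K0 hK] := thn_lip b0; exists K => // s t s0 st tb.
  apply/ler_addgt0Pr => e e0.
  have e3 : 0 < e / 3 by rewrite divr_gt0.
  have eK : 0 < e / 3 / K by rewrite divr_gt0.
  have [n /= [[h1 h2] h3]] := filter_ex (filterI (filterI (hth s _ e3) (hth t _ e3)) (Uh _ eK)).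
  rewrite ltr_pdivlMr// in h3.
  have := hK n s t s0 st tb.
  have := pnormB_le (th t) (thn n t) (th s).
  have := pnormB_le (thn n t) (thn n s) (th s).
  rewrite (pnormBC (th t) (thn n t)); lra.
move=> t d t0 hv v e e0 dl dl0; apply: contrapT => nex.
have H z s : pnorm (z - th t) < dl -> 0 < s -> s < dl ->
    f (z + s *: v) - f z < s * (pdot (- d) v - e).
  move=> y1 s1 s2; rewrite -ltr_pdivrMl// mulrC ltNge; apply/negP => le.
  by apply: nex; exists z, s.
have b0 : 0 <= t + 1 by lra.
have [K K0 hK] := thn_lip b0; have [K' K'0 hK'] := y_lip b0.
have nv := pnorm_ge0 v; set V := pnorm v + 1; have V0 : 0 < V by rewrite /V; lra.
have e8 : 0 < e / (8 * V) by rewrite divr_gt0// mulr_gt0.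
have [dv dv0 hdv] := hv _ e8.
(* [s0] lies in the range of the velocity expansion, and it keeps the iterates between t and t + s0
   within dl of th t: s0, the mesh and [eta] each use at most a quarter of dl. *)
pose s0 := Num.min (Num.min 1 (dv / 2)) (dl / (8 * K')).
have s00 : 0 < s0 by rewrite !lt_min ltr01 !divr_gt0// mulr_gt0.
have s01 : s0 <= 1 by rewrite !ge_min lexx.
have s0d : s0 <= dv / 2 by rewrite !ge_min lexx !orbT.
have s0K : s0 * (8 * K') <= dl.
  by rewrite -ler_pdivlMr ?mulr_gt0// !ge_min lexx !orbT.
(* A quarter of e pays for the quadratic and tolerance errors of each step; the rest exceeds the
   errors of the two limits, of the velocity and of the rounding of times. *)
pose c := pdot (- d) v - 3 / 4 * e.
pose eta := Num.min (dl / 4) (s0 * e / (32 * V)).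
have eta0 : 0 < eta by rewrite lt_min !divr_gt0 ?mulr_gt0.
have etad : eta <= dl / 4 by rewrite ge_min lexx.
have etaV : eta * (32 * V) <= s0 * e.
  by rewrite -ler_pdivlMr ?mulr_gt0// ge_min lexx orbT.
have g2 : 0 < dl / (8 * K') by rewrite divr_gt0// mulr_gt0.
have V2 : 0 < 4 * (V ^+ 2 + 1) by have := sqr_ge0 V; lra.
have g4 : 0 < e / (4 * (V ^+ 2 + 1)) by rewrite divr_gt0.
have c2 : 0 < 8 * (`|c| + 1) by have := normr_ge0 c; lra.
have g5 : 0 < s0 * e / (8 * (`|c| + 1)) by rewrite divr_gt0// mulr_gt0.
have [n /= [[hn1 hn2] [[[k1 k2] k3] [k4 k5]]]] := filter_ex
  (filterI (filterI (hth t _ eta0) (hth (t + s0) _ eta0))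
  (filterI (filterI (filterI (Uh 1 ltr01) (Uh _ g2)) (Uh dl dl0))
    (filterI (Uh _ g4) (Uh _ g5)))).
set hn := h n in k1 k2 k3 k4 k5; have hn0 : 0 < hn by exact: h_gt0.
rewrite ltr_pdivlMr ?mulr_gt0// in k2.
rewrite ltr_pdivlMr// in k4.
rewrite ltr_pdivlMr// in k5.
have ts0 : 0 <= t + s0 by lra.
rewrite /thn ger0_norm// in hn1; rewrite /thn ger0_norm// in hn2.
set i := idx n t in hn1; set j := idx n (t + s0) in hn2.
have ij : (i <= j)%N by apply: idx_homo; lra.
have jb : j%:R * hn <= t + 1 by apply: le_trans (idx_le n ts0) _; lra.
have i1 := idx_le n t0; have i2 := idx_gt n t0.
have j1 := idx_le n ts0; have j2 := idx_gt n ts0.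
rewrite -/i -/hn in i1 i2; rewrite -/j -/hn in j1 j2.
have near_t k : (i <= k)%N -> (k <= j)%N -> pnorm (y n k - th t) < dl.
  move=> ik kj; apply: le_lt_trans (pnormB_le _ (y n i) _) _.
  have kb : k%:R * h n <= t + 1.
    by apply: le_trans jb; rewrite ler_pM2r// ler_nat.
  have := hK' n i k ik kb; rewrite natrB// -/hn.
  have kj' : k%:R * hn <= j%:R * hn by rewrite ler_pM2r// ler_nat.
  have : K' * ((k%:R - i%:R) * hn) <= K' * (s0 + hn) by rewrite ler_pM2l//; lra.
  lra.
(* The near-minimizer is compared with its displacement by h^2 v: the cross term of the squared
   distance gives the increment paired with v, and [H] bounds the change of f. *)
have incr k : (i <= k)%N -> (k < j)%N ->
    - pdot (y n k.+1 - y n k) v <= hn * c.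
  move=> ik kj; have hs : 0 < hn ^+ 2 by rewrite exprn_gt0.
  have hsd : hn ^+ 2 < dl.
    by apply: lt_trans k3; rewrite expr2 gtr_pMl.
  have := H (y n k.+1) (hn ^+ 2) (near_t _ (leqW ik) kj) hs hsd.
  have [_ /(_ (y n k.+1 + hn ^+ 2 *: v))] := stepP n (y n k).
  rewrite -/(y n k.+1) -/hn.
  have -> : y n k.+1 + hn ^+ 2 *: v - y n k = (y n k.+1 - y n k) + hn ^+ 2 *: v.
    by rewrite addrAC.
  rewrite !pnorm_sqr.
  move: (y n k.+1 - y n k) => D.
  rewrite pdotDl !pdotDr !pdotZl !pdotZr (pdotC v D) => A1 A2.
  have vv : pdot v v <= V ^+ 2.
    by rewrite -pnorm_sqr ler_pXn2r ?nnegrE ?pnorm_ge0 ?ltW//; rewrite /V; lra.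
  rewrite -(ler_pM2l hn0).
  have A3 : - hn * pdot D v <= hn ^+ 2 * (pdot (- d) v - e) + hn ^+ 3 * pdot v v / 2 + hn ^+ 4.
    have A4 : (pdot D D + hn ^+ 2 * pdot D v + (hn ^+ 2 * pdot D v +
      hn ^+ 2 * (hn ^+ 2 * pdot v v))) / (2 * hn) = pdot D D / (2 * hn) +
      hn * pdot D v + hn ^+ 3 * pdot v v / 2 by field; rewrite gt_eqF.
    by move: A1; rewrite A4; lra.
  have A5 : hn ^+ 3 * pdot v v <= hn ^+ 3 * V ^+ 2.
    by rewrite ler_pM2l// exprn_gt0.
  have A6 : hn ^+ 2 * (hn * (4 * (V ^+ 2 + 1))) <= hn ^+ 2 * e.
    by rewrite ler_pM2l// ltW.
  have A7 : hn ^+ 4 <= hn ^+ 3.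
    by rewrite [leLHS]exprS ler_piMl ?exprn_ge0 ?ltW.
  have A8 : 0 <= hn ^+ 3 * V ^+ 2 by rewrite mulr_ge0 ?exprn_ge0 ?ltW.
  rewrite /c; lra.
have tele k : (i + k <= j)%N -> - pdot (y n (i + k) - y n i) v <= k%:R * (hn * c).
  elim: k => [|k IH] kj; first by rewrite addn0 subrr pdot0l oppr0 mul0r.
  rewrite addnS in kj *.
  have := incr (i + k)%N (leq_addr _ _) kj; have := IH (ltnW kj).
  rewrite !pdotBl -[k.+1%:R]natr1; lra.
have := tele (j - i)%N; rewrite subnKC// => /(_ (leqnn _)).
rewrite natrB// => T1.
(* Both endpoints are rounded down to the grid, so the elapsed discrete time differs from [s0] by at
   most one step. *)
have cb : (j%:R - i%:R) * (hn * c) <= s0 * c + hn * `|c|.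
  have -> : (j%:R - i%:R) * (hn * c) = s0 * c + (j%:R * hn - i%:R * hn - s0) * c by ring.
  rewrite lerD2l (le_trans (ler_norm _))// normrM ler_wpM2r//.
  by rewrite ler_norml; apply/andP; split; lra.
have CS w : `|pdot w v| <= pnorm w * V.
  apply: (@le_trans _ _ (pnorm w * pnorm v)).
    rewrite ler_norml pdot_CS andbT lerNl -pdotNl.
    by apply: le_trans (pdot_CS _ _) _; rewrite pnormN.
  by rewrite ler_wpM2l ?pnorm_ge0// /V; lra.
have etaCS w : pnorm w < eta -> `|pdot w v| <= eta * V.
  by move=> wl; apply: le_trans (CS w) _; rewrite ler_pM2r// ltW.
have := etaCS _ hn1; have := etaCS _ hn2.
rewrite !ler_norml !pdotBl => /andP[p1 p2] /andP[p3 p4].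
have := hdv s0; rewrite gtr0_norm// => /(_ ltac:(lra)) vel.
have := le_trans (CS _) (ler_wpM2r (ltW V0) vel).
have -> : e / (8 * V) * s0 * V = e / 8 * s0 by field; rewrite gt_eqF.
rewrite ler_norml !pdotBl pdotZl => /andP[q1 q2].
move: T1 cb; rewrite !pdotBl /c pdotNl => T1 cb.
have n1 : `|- pdot d v - 3 / 4 * e| = `|c| by rewrite /c pdotNl.
rewrite n1 in cb.
have hnc : hn * `|c| * 8 <= s0 * e.
  by have := normr_ge0 c; lra.
have se : 0 < s0 * e by rewrite mulr_gt0.
lra.
Qed.

End Scheme.
End ClarkeFlow.

(** * Extension of solutions *)

Section Extension.
Context {R : realType} {N d0 d1 d2 : nat}.
Variables (X : 'M[R]_(N, d0)) (Y : 'M[R]_(N, d2)).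
Notation P := (@param R d0 d1 d2).
Notation mu := (@lebesgue_measure R).
Implicit Types th : R -> P.

Definition lipschitz_until th (b K : R) := forall s t, 0 <= s -> s <= t ->
  t <= b -> pnorm (th t - th s) <= K * (t - s).

Lemma lipschitz_abs_cont th b K : 0 < K -> lipschitz_until th b K ->
  abs_cont_on 0 b th.
Proof.
move=> K0 hK e e0; exists (e / K); split; first by rewrite divr_gt0.
move=> n u w hu hw; rewrite ltr_pdivlMr// mulrC => h; apply: le_lt_trans h.
rewrite mulr_sumr; apply: ler_sum => k _.
by have [u0 [uw wb]] := hu k (ltn_ord k); exact: hK.
Qed.

Lemma trajectory_of_solution (th0 : P) T th b : is_solution X Y th0 T th ->
  0 <= b -> (b%:E < T)%E -> trajectory X Y th0 b th (fun t => 'D_1 th t)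
    [set t | [/\ 0 <= t, (t%:E < T)%E & ~ good X Y th t ('D_1 th t)]].
Proof.
move=> sol b0 bT; have nE := ae_good sol; have [h0 ac _] := sol; split=> //.
  exact: ac.
move=> t t0 tb nt; apply: contrapT => ng; apply: nt; split=> //.
by apply: le_lt_trans bT; rewrite lee_fin.
Qed.

(** The ultrafilter limit along times increasing to r inherits the Lipschitz estimate up to r, which
    is what gluing needs. *)
Lemma left_limit_exists th (r K : R) : 0 < r -> 0 < K ->
  (forall b, b < r -> lipschitz_until th b K) ->
  exists z, forall t, 0 <= t -> t < r -> pnorm (z - th t) <= K * (r - t).
Proof.
move=> r0 K0 hK; pose t_ (n : nat) := r - r / n.+1%:R.
have n1 n : 0 < r / n.+1%:R by rewrite divr_gt0.
have t0 n : 0 <= t_ n by rewrite subr_ge0 ler_pdivrMr// ler_peMr ?ler1n// ltW.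
have tr n : t_ n < r by rewrite /t_ ltrBlDr ltrDl.
have [U [UU Uoo]] := @ultraFilterLemma nat \oo _.
have UF : ProperFilter U by exact: ultra_proper.
have ub n : pnorm (th (t_ n)) <= pnorm (th 0) + K * r.
  apply: le_trans (pnorm_leD _ (th 0)) _; rewrite lerD2l.
  apply: le_trans (hK _ (tr n) 0 (t_ n) _ _ _) _ => //.
  by rewrite ler_pM2l// subr0 ltW.
have [z hz] := ultralim_param UU ub.
exists z => t t00 ttr; apply/ler_addgt0Pr => e e0.
have g0 : 0 < (r - t) / r by rewrite divr_gt0// subr_gt0.
have Ut : U [set n | n.+1%:R^-1 < (r - t) / r].
  by apply: Uoo; exact: (near_infty_natSinv_lt (PosNum g0)).
have [n /= [hn1 hn2]] := filter_ex (filterI (hz e e0) Ut).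
rewrite ltr_pdivlMr// mulrC in hn2.
have ttn : t <= t_ n by rewrite /t_ lerBrDr -lerBrDl ltW.
have := hK _ (tr n) t (t_ n) t00 ttn (lexx _).
have : K * (t_ n - t) <= K * (r - t) by rewrite ler_pM2l//; have := tr n; lra.
have := pnormB_le z (th (t_ n)) (th t).
rewrite (pnormBC z (th (t_ n))); lra.
Qed.

(** A Clarke flow from the left limit is attached at r. The glued curve is locally Lipschitz, hence
    absolutely continuous and differentiable almost everywhere; beyond r differentiability alone
    yields the inclusion. *)
Lemma extend_solution (th0 : P) (r K : R) th : 0 < r -> 0 < K ->
  is_solution X Y th0 r%:E th -> (forall b, b < r -> lipschitz_until th b K) ->
  exists th', is_solution X Y th0 +oo%E th' /\
    forall t, 0 <= t -> t < r -> th' t = th t.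
Proof.
move=> r0 K0 [h0 _ nE] hK.
have [z hz] := left_limit_exists r0 K0 hK.
have [th2 [z0 lip2 flow2]] := @clarke_flow_exists R d0 d1 d2 (loss X Y)
  (@loss_ge0 R N d0 d1 d2 X Y) (@loss_lipschitz R N d0 d1 d2 X Y) z.
pose th' t := if t < r then th t else th2 (t - r).
have lt_r t : t < r -> th' t = th t by move=> h; rewrite /th' h.
have ge_r t : r <= t -> th' t = th2 (t - r) by move=> h; rewrite /th' ltNge h.
have lip' b : 0 <= b -> exists2 K', 0 < K' & lipschitz_until th' b K'.
  move=> b0; have [K2 K20 hK2] := lip2 b b0.
  exists (K + K2); first by rewrite addr_gt0.
  move=> s t s0 st tb; rewrite mulrDl.
  have k1 : 0 <= K * (t - s) by rewrite mulr_ge0 ?(ltW K0)// subr_ge0.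
  have k2 : 0 <= K2 * (t - s) by rewrite mulr_ge0 ?(ltW K20)// subr_ge0.
  have [tr|rt] := ltP t r.
    rewrite (lt_r _ tr) (lt_r _ (le_lt_trans st tr)).
    have := hK t tr s t s0 st (lexx _); lra.
  have [sr|rs] := ltP s r.
    rewrite (ge_r _ rt) (lt_r _ sr); have := hz s s0 sr.
    have := hK2 0 (t - r) (lexx _) ltac:(by rewrite subr_ge0) ltac:(lra).
    rewrite z0 => h1 h2; have := pnormB_le (th2 (t - r)) z (th s).
    have : K * (r - s) <= K * (t - s) by rewrite ler_pM2l//; lra.
    have : K2 * (t - r - 0) <= K2 * (t - s) by rewrite ler_pM2l//; lra.
    lra.
  rewrite (ge_r _ rt) (ge_r _ rs).
  have := hK2 (s - r) (t - r) ltac:(lra) ltac:(lra) ltac:(lra).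
  have -> : t - r - (s - r) = t - s by ring.
  lra.
exists th'; split; last by move=> t _; exact: lt_r.
split; first by rewrite lt_r.
  by move=> b b0 _; have [K' K'0 hK'] := lip' b b0; exact: lipschitz_abs_cont hK'.
have n1 (a : R) : mu.-negligible [set a].
  by apply/negligibleP; [exact: measurable_set1|exact: lebesgue_measure_set1].
have nD : mu.-negligible (\bigcup_n
    [set t | [/\ 0 < t, t < n.+1%:R & ~ derivable th' t 1]]).
  apply: negligible_bigcup => n.
  have [K' K'0 hK'] := lip' n.+1%:R (ler0n _ _).
  by apply: (@lipschitz_ae_derivable_param R d0 d1 d2 th' n.+1%:R K').
(* Time 0 is added because [nD] concerns positive times only, and time r because the inclusion is
   not checked at the junction. *)
apply: negligibleS (negligibleU (negligibleU (n1 0) (n1 r)) (negligibleU nE nD)).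
move=> t /= [t0 _ bad].
have [->|tn0] := eqVneq t 0; first by left; left.
have [->|tnr] := eqVneq t r; first by left; right.
right; have tp : 0 < t by rewrite lt_def tn0.
have [tr|rt] := ltP t r.
  left; split; [exact: t0|by rewrite lte_fin|].
  move=> [dth cth]; apply: bad.
  have nq : \forall s \near t, th s = th' s.
    by near=> s; rewrite lt_r//; near: s; exact: lt_nbhsl.
  split; first exact: near_eq_derivable dth.
  by rewrite -(near_eq_derive _ nq) lt_r.
have /andP[_ tb] := truncn_itv (ltW tp).
right; exists (Num.truncn t); first by [].
split; [exact: tp|exact: tb|move=> dth; apply: bad; split; first exact: dth].
have tr : r < t by rewrite lt_def tnr.
rewrite ge_r//; apply: flow2; first by rewrite subr_ge0.
move=> e e0; have [d dd hd] := derivable_pnorm dth e0.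
exists (Num.min d (t - r)); first by rewrite lt_min dd subr_gt0.
move=> h; rewrite lt_min => /andP[h1 h2].
have := hd h h1; rewrite (ge_r _ rt) ge_r.
  by have -> : t + h - r = t - r + h by ring.
by move: h2; rewrite ltr_norml => /andP[]; lra.
Unshelve. all: by end_near. Qed.

End Extension.

Theorem theorem3p4 (R : realType) (N d0 d1 d2 : nat)
  (X : 'M[R]_(N, d0)) (Y : 'M[R]_(N, d2))
  (W0 : 'M[R]_(d0, d1)) (V0 : 'M[R]_(d1, d2)) :
  let th0 : param d0 d1 d2 := (W0, V0) in
  let a := Num.sqrt (loss X Y th0) in
  let alpha := sigma_min (relu (X *m W0))^T in
  let c1 := 2 * Num.sqrt 2 * opnorm X ^+ 2 * frob V0 in
  let c2 := 2 * opnorm X ^+ 3 * frob W0 in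
  let c := opnorm X ^+ 2 in
  let u := 4 * opnorm X * Num.sqrt (loss X Y th0) / alpha ^+ 2 in
  0 < alpha ->
  (a * c1 / alpha ^+ 3 + a ^+ 2 * c2 / alpha ^+ 5)
    * expR (4 * c * a ^+ 2 / alpha ^+ 4) < 8^-1 ->
  (forall (T : \bar R), (0 < T)%E ->
     forall th : R -> param d0 d1 d2, is_solution X Y th0 T th ->
     exists th' : R -> param d0 d1 d2,
       is_solution X Y th0 +oo%E th' /\
       (forall t : R, 0 <= t -> (t%:E < T)%E -> th' t = th t)) /\
  (forall th : R -> param d0 d1 d2, is_solution X Y th0 +oo%E th ->
     forall t : R, 0 <= t ->
       loss X Y (th t) <= loss X Y (th 0) * expR (- (t * alpha ^+ 2)) /\
       pnorm (th t - th 0) <= u * pnorm (th 0) * expR u).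
Proof.
move=> th0 a alpha c1 c2 c u alpha0 F8; split; last first.
  move=> th sol t t0.
  have tr := trajectory_of_solution sol t0 (ltry t).
  have [-> _ _] := sol; split.
    exact: (@trajectory_loss _ _ _ _ _ X Y th0 alpha0 F8 _ _ _ _ t0 tr).
  exact: (@trajectory_pnorm _ _ _ _ _ X Y th0 alpha0 F8 _ _ _ _ t0 tr).
(* For T = +oo the solution extends itself; T = -oo contradicts T > 0. *)
case=> [r||] //= T0 th sol; last by exists th; split.
rewrite lte_fin in T0.
have [K K0 hK] : exists2 K : R, 0 < K & forall b, b < r -> lipschitz_until th b K.
  set K := opnorm X * (Num.sqrt 2 * a) * (pnorm th0 + u * pnorm th0 * expR u).
  (* The gluing asks for a positive constant, while K vanishes for instance when the initial loss is
     0. *)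
  exists (Num.max K 1); first by rewrite lt_max ltr01 orbT.
  move=> b br s t s0 st tb.
  have b0 : 0 <= b by exact: le_trans (le_trans s0 st) tb.
  have brE : (b%:E < r%:E)%E by rewrite lte_fin.
  have tr := trajectory_of_solution sol b0 brE.
  apply: le_trans (@trajectory_lipschitz _ _ _ _ _ X Y th0 alpha0 F8
    _ _ _ _ _ _ s0 st tb tr) _.
  by rewrite ler_wpM2r ?subr_ge0// le_max lexx.
have [th' [sol' eqth]] := extend_solution T0 K0 sol hK.
exists th'; split=> // t t0; rewrite lte_fin; exact: eqth.
Qed.
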